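(* Let $\sigma$ be a type and $\mathcal O\subseteq\mathbb F$ a regular set of $\sigma$-forests. Then the set of (isomorphism classes of) cores of the minimal elements of $\mathcal O$ is regular.
   Context: A type $\sigma$ is a finite set of relation symbols with arities; a $\sigma$-structure $\mathbf A$ is a finite set $V(\mathbf A)$ with an $r$-ary relation $R(\mathbf A)$ for each $R\in\sigma$ of arity $r$. Homomorphisms preserve all relations; $\mathbf A\to\mathbf B$ means one exists. The core of $\mathbf A$ is a structure homomorphically equivalent to $\mathbf A$ with the minimum number of vertices (unique up to isomorphism). An element $\mathbf A\in\mathcal O$ is minimal in $\mathcal O$ if for every $\mathbf C\in\mathcal O$ with $\mathbf C\to\mathbf A$ we have $\mathbf A\to\mathbf C$. The incidence multigraph $\mathrm{Inc}(\mathbf A)$ is bipartite with parts $V(\mathbf A)$ and the blocks $(R,(x_1,\dots,x_r))$, $(x_1,\dots,x_r)\in R(\mathbf A)$, with an edge joining $x_i$ to the block for each $i$. $\mathbf A$ is a $\sigma$-forest if $\mathrm{Inc}(\mathbf A)$ has no cycles or parallel edges. $\mathbb F$ is the set of isomorphism classes of $\sigma$-forests, $\mathbb F_{\mathrm r}$ that of rooted $\sigma$-forests $(\mathbf A,a)$, $a\in V(\mathbf A)$. $(\mathbf A,a)+(\mathbf B,b)$ is the disjoint union with $a,b$ identified (new root); $[(\mathbf A,a)]$ forgets the root. For $\mathcal O\subseteq\mathbb F$, $\mathcal O-(\mathbf A,a)=\{(\mathbf B,b)\in\mathbb F_{\mathrm r}:[(\mathbf A,a)+(\mathbf B,b)]\in\mathcal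 O\}$; $\mathcal O$ is regular if there are only finitely many distinct sets $\mathcal O-(\mathbf A,a)$, $(\mathbf A,a)\in\mathbb F_{\mathrm r}$. *)

(* Defs.v *)
From mathcomp Require Import all_boot.
Set Implicit Arguments. Unset Strict Implicit. Unset Printing Implicit Defensive.

Section Forests.
Variables (S : finType) (ar : S -> nat).

Record struct := Struct {
  nv : nat;
  rel : forall s : S, {set (ar s).-tuple 'I_nv}
}.

Definition homf (A B : struct) (f : 'I_(nv A) -> 'I_(nv B)) :=
  forall (s : S) (t : (ar s).-tuple 'I_(nv A)),
    t \in rel A s -> map_tuple f t \in rel B s.

Definition hom (A B : struct) := exists f, @homf A B f.

Definition iso (A B : struct) :=
  exists f : 'I_(nv A) -> 'I_(nv B), bijective f /\
    forall (s : S) (t : (ar s).-tuple 'I_(nv A)),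
      (t \in rel A s) <-> (map_tuple f t \in rel B s).

Definition is_core_of (C A : struct) :=
  hom A C /\ hom C A /\
  forall D : struct, hom A D -> hom D A -> nv C <= nv D.

(* blocks of the incidence multigraph *)
Definition block (A : struct) := {s : S & (ar s).-tuple 'I_(nv A)}.
Definition is_block (A : struct) (b : block A) := tagged b \in rel A (tag b).

Definition no_parallel (A : struct) :=
  forall (s : S) (t : (ar s).-tuple 'I_(nv A)), t \in rel A s -> uniq t.

(* a cycle x_0 b_0 x_1 b_1 ... x_{k-1} b_{k-1} x_0 in Inc(A), k >= 2,
   with distinct vertices x_i and distinct blocks b_i *)
Definition has_cycle (A : struct) :=
  exists (k : nat) (xs : 'I_k -> 'I_(nv A)) (bs : 'I_k -> block A),
    [/\ 2 <= k, injective xs, injective bs &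
      forall i : 'I_k, [/\ is_block (bs i), xs i \in (tagged (bs i) : seq _)
                        & xs (ordS i) \in (tagged (bs i) : seq _)]].

Definition forest (A : struct) := no_parallel A /\ ~ has_cycle A.

Definition rstruct := {A : struct & 'I_(nv A)}.

(* C is (isomorphic to) [(A,a) + (B,b)]: disjoint union with a, b identified *)
Definition glued (A : struct) (a : 'I_(nv A)) (B : struct) (b : 'I_(nv B))
    (C : struct) :=
  exists (fA : 'I_(nv A) -> 'I_(nv C)) (fB : 'I_(nv B) -> 'I_(nv C)),
    [/\ injective fA, injective fB, fA a = fB b &
        (forall x y, fA x = fB y -> x = a /\ y = b)] /\
    ((forall z, (exists x, z = fA x) \/ (exists y, z = fB y)) /\
        forall (s : S) (t : (ar s).-tuple 'I_(nv C)),
          t \in rel C s <->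
          ((exists2 tA, tA \in rel A s & t = map_tuple fA tA) \/
           (exists2 tB, tB \in rel B s & t = map_tuple fB tB))).

(* sets of isomorphism classes of forests: iso-invariant predicates on forests *)
Definition iso_invariant (O : struct -> Prop) :=
  forall A B, iso A B -> O A -> O B.

Definition residual (O : struct -> Prop) (Aa : rstruct) (Bb : rstruct) :=
  exists C, @glued (tag Aa) (tagged Aa) (tag Bb) (tagged Bb) C /\ O C.

(* regular: finitely many distinct sets O - (A,a), (A,a) a rooted forest
   (two such sets being equal iff they contain the same rooted forests) *)
Definition regular (O : struct -> Prop) :=
  exists (m : nat) (P : 'I_m -> rstruct -> Prop),
    forall Aa : rstruct, forest (tag Aa) ->
      exists i : 'I_m, forall Bb : rstruct, forest (tag Bb) ->
        (P i Bb <-> residual O Aa Bb).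

Definition minimal_in (O : struct -> Prop) (A : struct) :=
  O A /\ forall C, O C -> hom C A -> hom A C.

(* cores of the minimal elements of O (closed under isomorphism) *)
Definition cores_of_minimal (O : struct -> Prop) (C : struct) :=
  exists A, minimal_in O A /\ is_core_of C A.

End Forests.

(* Main.v *)
Require Import Defs.
From mathcomp Require Import all_boot boolp.
Set Implicit Arguments. Unset Strict Implicit. Unset Printing Implicit Defensive.

(* A structure T is a core of a minimal element of O iff some member of O maps to
   T and every homomorphism f : C -> T with C in O has a section; being a core is
   then automatic, since f followed by an endomorphism of T has a section too.

   For a forest T and a vertex v, orient T away from v. A map f : C -> T has no
   section over the component of v iff f lifts to the structure whose points are
   pairs (x, w), where w is either None or a block b behind x, and where a point
   (x, Some b) lies in a block over b only together with some (y, w'), y behind b,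
   w' <> None (w = Some b records that the part of T behind b does not lift),
   with (v, None) removed. Hence membership of T = A + B
   amounts to statements "some forest of O maps to the amalgam of X and Y", where
   X is built from A, Y is built from B, and amalgamation takes place only over
   the root, whose points carry labels from a finite set.

   Whether some forest of O maps to such an amalgam depends, for fixed Y, only on a
   function between finite sets attached to X: it takes the residual classes of
   rooted forests that may be hung from the other side at points with a given
   label, and returns the classes that X can then realize. So rooted forests have
   finitely many types, and the type of (A,a) determines its residual. *)

(** The choice of v is what makes the criterion split between A and B. Over the component of the
    root, v is the root itself, so the orientation restricts to A away from a and to B away from b,
    and the two parts fail or lift separately. Every other component lies in one summand, and the
    other summand enters unchanged. The block b in a pair (x, Some b) cannot be part of a label,
    since the blocks of A are not bounded in number; a label therefore only says which side is to
    blame. Two kinds of blocks escape this scheme: a block of arity 0 lies in no component and gets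
    a target of its own, and a block of arity 1 at the root can come from both summands at once.

    A map to an amalgam may pass between X and Y many times. Regularity of O is used to forget each
    piece beyond a crossing except for its residual class: exchanging pieces of equal class keeps
    the whole forest in O. *)

Section Tuples.
Variable n : nat.

Lemma map_tuple_comp (T U V : Type) (f : T -> U) (g : U -> V) (t : n.-tuple T) :
  map_tuple g (map_tuple f t) = map_tuple (g \o f) t.
Proof. by apply: val_inj; rewrite /= -map_comp. Qed.

Lemma eq_map_tuple (T U : Type) (f g : T -> U) (t : n.-tuple T) :
  (forall i, f (tnth t i) = g (tnth t i)) -> map_tuple f t = map_tuple g t.
Proof. by move=> h; apply: eq_from_tnth => i; rewrite !tnth_map. Qed.

Lemma map_tuple_id (T : Type) (f : T -> T) (t : n.-tuple T) :
  (forall i, f (tnth t i) = tnth t i) -> map_tuple f t = t.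
Proof. by move=> h; apply: eq_from_tnth => i; rewrite tnth_map. Qed.

Lemma map_tuple_inj (T U : Type) (f : T -> U) (t t' : n.-tuple T) :
  injective f -> map_tuple f t = map_tuple f t' -> t = t'.
Proof.
move=> fi /(congr1 (fun t => tnth t)) e; apply: eq_from_tnth => i.
by apply: fi; move/(congr1 (fun h => h i)): e; rewrite !tnth_map.
Qed.

Lemma map_tuple_eqP (T T' U : Type) (f : T -> U) (g : T' -> U)
  (t : n.-tuple T) (t' : n.-tuple T') :
  map_tuple f t = map_tuple g t' <-> forall i, f (tnth t i) = g (tnth t' i).
Proof.
split=> [/(congr1 (fun t => tnth t)) e i|h].
  by move/(congr1 (fun h => h i)): e; rewrite !tnth_map.
by apply: eq_from_tnth => i; rewrite !tnth_map.
Qed.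

Lemma tuple_choice (T : Type) (P : 'I_n -> T -> Prop) :
  (forall i, exists x, P i x) -> exists t : n.-tuple T, forall i, P i (tnth t i).
Proof.
move=> /choice[f h]; exists [tuple f i | i < n] => i.
by rewrite tnth_mktuple.
Qed.

End Tuples.

(** * Structures on finite types, rooted isomorphism, sums with one new block *)

Section Main.
Variables (S : finType) (ar : S -> nat).
Notation struct := (struct ar).
Notation rstruct := (rstruct ar).
Notation V A := 'I_(nv A).
Local Notation rel := Defs.rel.

Section Mk.
Variables (T : finType) (R : forall s : S, (ar s).-tuple T -> Prop).

(** Vertices of a structure are ordinals; [mk] lets subsets, sums and sigma types serve as vertex
    sets through their enumeration. *)
Definition mk : struct :=
  @Struct S ar #|T| (fun s => [set t | `[< R (map_tuple enum_val t) >]]).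
Definition mk_in (x : T) : V mk := enum_rank x.
Definition mk_out (x : V mk) : T := enum_val x.

Lemma mk_inK : cancel mk_in mk_out. Proof. exact: enum_rankK. Qed.
Lemma mk_outK : cancel mk_out mk_in. Proof. exact: enum_valK. Qed.

Lemma mk_rel s (t : (ar s).-tuple (V mk)) :
  t \in rel mk s <-> R (map_tuple mk_out t).
Proof. by rewrite inE; split=> /asboolP. Qed.

Lemma mk_rel_in s (t : (ar s).-tuple T) :
  map_tuple mk_in t \in rel mk s <-> R t.
Proof.
rewrite mk_rel map_tuple_comp (map_tuple_id (t := t)) // => i /=.
exact: mk_inK.
Qed.

End Mk.

Lemma forest_inj_hom (A B : struct) (f : V A -> V B) :
  injective f -> homf f -> forest B -> forest A.
Proof.
move=> fi fh [np nc]; split=> [s t /fh /np|[k [xs [bs [k2 xi bi hc]]]]].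
  by rewrite /= map_inj_uniq.
apply: nc; exists k, (f \o xs).
exists (fun i => existT _ (tag (bs i)) (map_tuple f (tagged (bs i)))).
split=> // [|i j e|i]; first exact: inj_comp.
- apply: bi; move: e; case: (bs i) => s t; case: (bs j) => s' t' /= e.
  have es : s = s' by exact: (congr1 tag e).
  move: t' e; rewrite -es => t' /eqP; rewrite -tag_eqE /tag_eq /= eqxx tagged_asE.
  by move=> /eqP/(map_tuple_inj fi) ->.
- have [b0 x1 x2] := hc i; split; first exact: fh.
  + exact: map_f.
  + exact: map_f.
Qed.

Definition dot : rstruct := existT _ (@Struct S ar 1 (fun=> set0)) ord0.

Definition riso (D D' : rstruct) :=
  exists e : V (tag D) -> V (tag D'), [/\ bijective e, e (tagged D) = tagged D' &
    forall s (t : (ar s).-tuple _), t \in rel _ s <-> map_tuple e t \in rel _ s].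

Lemma riso_sym D D' : riso D D' -> riso D' D.
Proof.
move=> [e [[e' K K'] er eR]]; exists e'; split; first by exists e.
  by rewrite -er K.
move=> s t; rewrite eR map_tuple_comp (map_tuple_id (t := t)) // => i /=.
exact: K'.
Qed.

Lemma riso_residual O D D' B : riso D D' -> residual O D B -> residual O D' B.
Proof.
move=> /riso_sym[e [eb er eR]] [C [[fA [fB [[iA iB e0 ov] [cov R]]]] OC]].
exists C; split=> //; exists (fA \o e), fB.
have [e' K K'] := eb.
split; first split=> //.
- exact: inj_comp (bij_inj eb).
- by rewrite /= er.
- by move=> x y /ov[h ->]; split=> //; apply: (bij_inj eb); rewrite er.
split=> [z|s t].
  by case: (cov z) => [[x ->]|]; [left; exists (e' x); rewrite /= K'|right].
rewrite R; split=> -[[tA hA ->]|h]; [left|by right|left|by right].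
  exists (map_tuple e' tA); last first.
    rewrite map_tuple_comp; apply: eq_map_tuple => i /=; by rewrite K'.
  by apply/eR; rewrite map_tuple_comp (map_tuple_id (t := tA)) // => i /=; rewrite K'.
exists (map_tuple e tA); first exact/eR.
by rewrite map_tuple_comp.
Qed.

(* The disjoint union of the D k, with a new block s on the roots selected by t if
   beta = Some (s, t). *)
Section Sb.
Variables (n : nat) (beta : option {s : S & (ar s).-tuple 'I_n}).
Variable D : 'I_n -> rstruct.

Definition sb_point := {k : 'I_n & V (tag (D k))}.
Definition sb_pt k (x : V (tag (D k))) : sb_point := existT _ k x.
Definition sb_root k : sb_point := sb_pt (tagged (D k)).

Definition sb_struct : struct := @mk sb_point (fun s t =>
  (exists k, exists2 tk : (ar s).-tuple (V (tag (D k))), tk \in rel (tag (D k)) s &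
     t = map_tuple (@sb_pt k) tk) \/
  (exists2 t0, beta = Some (existT _ s t0) & t = map_tuple sb_root t0)).

Definition sb (i : 'I_n) : rstruct := existT _ sb_struct (mk_in _ (sb_root i)).

Lemma sb_pt_inj k : injective (@sb_pt k).
Proof. by move=> x y /eqP; rewrite -tag_eqE /tag_eq /= eqxx tagged_asE => /eqP. Qed.

End Sb.

Definition leres O (D D' : rstruct) :=
  forall B : rstruct, forest (tag B) -> residual O D B -> residual O D' B.

End Main.

(** * Residual classes are a congruence for disjoint union with one new block *)

Section Congruence.
Variables (S : finType) (ar : S -> nat).
Notation struct := (struct ar).
Notation rstruct := (rstruct ar).
Notation V A := 'I_(nv A).
Local Notation rel := Defs.rel.

Variable O : struct -> Prop.
Hypothesis O_forest : forall A, O A -> forest A.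
Variables (n : nat) (beta : option {s : S & (ar s).-tuple 'I_n}) (i : 'I_n).
Variable B : rstruct.

(** The embedding of [D] is hidden and only its image [W] and its blocks [T] in [C] are kept.
    Exchanging one piece of a family is then a case distinction on two predicates, with no
    dependently typed family of maps. *)
Definition part (C : struct) (W : V C -> Prop)
    (T : forall s, (ar s).-tuple (V C) -> Prop) (z : V C) (D : rstruct) :=
  exists f : V (tag D) -> V C,
    [/\ injective f, f (tagged D) = z, forall x, W x <-> exists y, x = f y &
      forall s t, T s t <-> exists2 t', t' \in rel (tag D) s & t = map_tuple f t'].

(* A member of O decomposes into copies of the E k, the block beta on their roots,
   and a copy of B glued at the root of the i-th one. *)
Definition hyb (E : 'I_n -> rstruct) := exists C, O C /\
  exists (z : 'I_n -> V C) (W : 'I_n -> V C -> Prop)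
         (T : 'I_n -> forall s, (ar s).-tuple (V C) -> Prop) (fB : V (tag B) -> V C),
  [/\ forall k, part (W k) (T k) (z k) (E k),
      [/\ injective fB, fB (tagged B) = z i &
        forall k y, W k (fB y) -> fB y = z i /\ k = i],
      forall k l x, W k x -> W l x -> k = l,
      forall x, (exists k, W k x) \/ exists y, x = fB y &
      forall s t, t \in rel C s <-> [\/ exists k, T k s t,
         exists2 tB, tB \in rel (tag B) s & t = map_tuple fB tB |
         exists2 t0, beta = Some (existT _ s t0) & t = map_tuple z t0]].

Lemma hyb_of_residual D : residual O (sb beta D i) B -> hyb D.
Proof.
move=> [C [[fA [fB [[iA iB e0 ov] [cov R]]]] OC]].
exists C; split=> //.
pose h k (x : V (tag (D k))) := fA (mk_in _ (sb_pt x)).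
have hi k l x y : @h k x = @h l y -> @sb_pt _ _ _ D k x = sb_pt y.
  by move/iA/(can_inj (mk_inK _)).
exists (fun k => h k (tagged (D k))), (fun k x => exists y, x = h k y),
  (fun k s t => exists2 t', t' \in rel (tag (D k)) s & t = map_tuple (@h k) t'), fB.
split.
- move=> k; exists (h k); split=> // x y /hi; exact: sb_pt_inj.
- split=> // k y [x e].
  have [ex ey] := ov _ _ (esym e); rewrite ey -e0; split=> //.
  by move/(can_inj (mk_inK _)): ex => /(congr1 tag).
- by move=> k l x [y ->] [y' /hi/(congr1 tag)].
- move=> x; case: (cov x) => [[y ->]|]; last by right.
  left; rewrite -(mk_outK y); case: (mk_out y) => k y'; exists k; exists y' => //.
- move=> s t; rewrite R; split.
  + case=> [[tA /mk_rel h1 ->]|h1]; last by apply: Or32.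
    have tAE : tA = map_tuple (mk_in _) (map_tuple (@mk_out _ _ _ _) tA).
      by rewrite map_tuple_comp map_tuple_id // => j /=; rewrite mk_outK.
    case: h1 => [[k [tk hk etk]]|[t0 eb etk]].
    * apply: Or31; exists k; exists tk => //; rewrite tAE etk !map_tuple_comp.
      exact: eq_map_tuple.
    * apply: Or33; exists t0 => //; rewrite tAE etk !map_tuple_comp.
      exact: eq_map_tuple.
  + case=> [[k [t' h1 ->]]|h1|[t0 eb ->]]; [left|by right|left].
    * exists (map_tuple (mk_in _) (map_tuple (@sb_pt _ _ _ D k) t')).
        by apply/mk_rel_in; left; exists k; exists t'.
      by rewrite !map_tuple_comp; apply: eq_map_tuple.
    * exists (map_tuple (mk_in _) (map_tuple (@sb_root _ _ _ D) t0)).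
        by apply/mk_rel_in; right; exists t0.
      by rewrite !map_tuple_comp; apply: eq_map_tuple.
Qed.

Lemma residual_of_hyb D : hyb D -> residual O (sb beta D i) B.
Proof.
move=> [C [OC [z [W [T [fB [hp [iB e0 ov] dj cov R]]]]]]].
have {}hp k : exists f : V (tag (D k)) -> V C,
    [/\ injective f, f (tagged (D k)) = z k, forall x, W k x <-> exists y, x = f y &
      forall s t, T k s t <-> exists2 t', t' \in rel (tag (D k)) s & t = map_tuple f t'].
  exact: hp.
pose f k := projT1 (cid (hp k)).
have fP k : [/\ injective (f k), f k (tagged (D k)) = z k, forall x, W k x <-> exists y, x = f k y &
      forall s t, T k s t <-> exists2 t', t' \in rel (tag (D k)) s & t = map_tuple (f k) t'].
  exact: (projT2 (cid (hp k))).
pose h (p : sb_point D) := f (tag p) (tagged p).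
have Wh p : W (tag p) (h p) by have [_ _ w _] := fP (tag p); apply/w; exists (tagged p).
have hi : injective h.
  move=> [k x] [l y] e; have el : k = l.
    by apply: (dj _ _ _ (Wh (existT _ k x))); rewrite e; apply: (Wh (existT _ l y)).
  subst l; congr existT; have [fi _ _ _] := fP k; exact: fi e.
have hz k : h (sb_root D k) = z k by rewrite /h /=; have [_ -> _ _] := fP k.
exists C; split=> //; exists (h \o @mk_out _ _ _ _), fB; split.
  split=> //.
  - by apply: inj_comp; [exact: hi | exact: (can_inj (mk_outK (R := _)))].
  - by rewrite /= mk_inK hz e0.
  - move=> x y /= e; have := Wh (mk_out x); rewrite e => /ov[ey ei].
    split; last by apply: iB; rewrite ey e0.
    apply: (can_inj (mk_outK (R := _))); rewrite mk_inK.
    by apply: hi; rewrite e hz ey.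
split=> [x|s t].
  case: (cov x) => [[k wk]|]; last by right.
  left; have [_ _ w _] := fP k; have [y ->] := (w x).1 wk.
  by exists (mk_in _ (sb_pt y)); rewrite /= mk_inK.
rewrite R; split.
  case=> [[k]|h1|[t0 eb ->]]; [|by right|].
    have [_ _ _ r] := fP k => /r[t' ht ->]; left.
    exists (map_tuple (mk_in _) (map_tuple (@sb_pt _ _ _ D k) t')).
      by apply/mk_rel_in; left; exists k; exists t'.
    by rewrite !map_tuple_comp; apply: eq_map_tuple => j; rewrite /= mk_inK.
  left; exists (map_tuple (mk_in _) (map_tuple (@sb_root _ _ _ D) t0)).
    by apply/mk_rel_in; right; exists t0.
  by rewrite !map_tuple_comp; apply: eq_map_tuple => j; rewrite /= mk_inK hz.
case=> [[tA /mk_rel h1 ->]|h1]; last by apply: Or32.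
case: h1 => [[k [tk hk etk]]|[t0 eb etk]].
  apply: Or31; exists k; have [_ _ _ r] := fP k; apply/r; exists tk => //.
  by rewrite -map_tuple_comp etk map_tuple_comp; apply: eq_map_tuple.
apply: Or33; exists t0 => //.
by rewrite -map_tuple_comp etk map_tuple_comp; apply: eq_map_tuple => j; rewrite /= hz.
Qed.

(* The context of the j-th piece is cut out of the forest C, hence is itself a
   forest, and so the definition of a residual applies to it. *)
Lemma hyb_replace E j R' : forest (tag B) -> leres O (E j) R' -> hyb E ->
  hyb (fun k => if k == j then R' else E k).
Proof.
move=> fstB le [C [OC [z [W [T [fB [hp [iB e0 ov] dj cov R]]]]]]].
pose P x := `[< ~ W j x \/ x = z j >].
(* The context is not an induced substructure: a block with no vertex other than [z j] may belong to
   the piece, to the context, or to both. *)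
pose Rest s t := [\/ exists2 k, k != j & T k s t,
         exists2 tB, tB \in rel (tag B) s & t = map_tuple fB tB |
         exists2 t0, beta = Some (existT _ s t0) & t = map_tuple z t0].
have Pz k : P (z k).
  apply/asboolP; have [->|kj] := eqVneq k j; first by right.
  left=> wj; have [f [_ fz w _]] := hp k.
  have wk : W k (z k) by apply/w; exists (tagged (E k)).
  by rewrite (dj _ _ _ wj wk) eqxx in kj.
have PB y : P (fB y).
  by apply/asboolP; have [/ov[-> ->]|] := pselect (W j (fB y)); [right|left].
have PW k x : k != j -> W k x -> P x.
  move=> kj wk; apply/asboolP; left => wj.
  by rewrite (dj _ _ _ wj wk) eqxx in kj.
have PT k s (t : (ar s).-tuple _) l : k != j -> T k s t -> P (tnth t l).
  move=> kj; have [f [_ _ w r]] := hp k => /r[t' _ ->].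
  by apply: (PW k) => //; apply/w; exists (tnth t' l); rewrite tnth_map.
have PR s (t : (ar s).-tuple _) l : Rest s t -> P (tnth t l).
  case=> [[k kj tk]|[tB _ ->]|[t0 _ ->]]; first exact: PT tk.
    by rewrite tnth_map.
  by rewrite tnth_map.
pose X := mk (fun s (t : (ar s).-tuple {x | P x}) => Rest s (map_tuple val t)).
pose Xx (x : V C) (px : P x) : V X := mk_in _ (exist _ x px).
pose xX (x : V X) : V C := val (mk_out x).
have xXK x px : xX (@Xx x px) = x by rewrite /xX mk_inK.
have xXi : injective xX by move=> x y /val_inj /(can_inj (mk_outK (R := _))).
have PxX x : P (xX x) by rewrite /xX; case: (mk_out x).
have lift s (t : (ar s).-tuple _) : Rest s t ->
    exists2 t', t' \in rel X s & t = map_tuple xX t'.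
  move=> rt.
  have [t' ht] : exists t' : (ar s).-tuple (V X), forall l, xX (tnth t' l) = tnth t l.
    apply: (tuple_choice (P := fun l x => xX x = tnth t l)) => l.
    by exists (Xx _ (PR _ _ l rt)).
  have et : t = map_tuple xX t' by apply: eq_from_tnth => l; rewrite tnth_map.
  exists t' => //; apply/mk_rel; rewrite map_tuple_comp.
  by rewrite (_ : map_tuple _ _ = t).
have RX s t' : t' \in rel X s <-> Rest s (map_tuple xX t').
  by rewrite mk_rel map_tuple_comp.
have hX : homf xX.
  move=> s t' /RX h; apply/R; case: h => [[k _ h]|h|h].
  - by apply: Or31; exists k.
  - by apply: Or32.
  - by apply: Or33.
pose rX : rstruct := existT _ X (Xx _ (Pz j)).
have fX : forest (tag rX) by apply: forest_inj_hom xXi hX (O_forest OC).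
have [fj [fji fjz fjW fjT]] := hp j.
have /(le _ fX)[C' [[gD [gX [[iD iX eD ovD] [covD RD]]]] OC']] : residual O (E j) rX.
  exists C; split=> //; exists fj, xX; split.
    split=> //; first by rewrite /= xXK.
    move=> x y e; have Wj : W j (xX y) by rewrite -e; apply/fjW; exists x.
    have ey : xX y = z j by case/asboolP: (PxX y).
    split; first by apply: fji; rewrite e ey fjz.
    by apply: xXi; rewrite ey /= xXK.
  split=> [x|s t].
    have [/fjW|nW] := pselect (W j x); first by left.
    have px : P x by apply/asboolP; left.
    by right; exists (Xx x px); rewrite xXK.
  rewrite R; split.
    have rest : Rest s t -> exists2 t', t' \in rel X s & t = map_tuple xX t' by exact: lift.
    case=> [[k tk]|h|h].
    - have [kj|kj] := eqVneq k j; first by left; apply/fjT; rewrite -kj.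
      by right; apply: rest; apply: Or31; exists k.
    - by right; apply: rest; apply: Or32.
    - by right; apply: rest; apply: Or33.
  case=> [/fjT h|[t' /RX h ->]]; first by apply: Or31; exists j.
  case: h => [[k _ h]|h|h].
  - by apply: Or31; exists k.
  - by apply: Or32.
  - by apply: Or33.
(* The value off [P] is a dummy: [h] is only applied to vertices of the context. *)
pose h (x : V C) : V C' := if insub x is Some x' then gX (mk_in _ x') else gD (tagged R').
have hE x (px : P x) : h x = gX (Xx x px) by rewrite /h insubT.
have hX' x : h (xX x) = gX x.
  by rewrite (hE _ (PxX x)); congr gX; apply: xXi; rewrite xXK.
have hinj x y : P x -> P y -> h x = h y -> x = y.
  by move=> px py; rewrite (hE _ px) (hE _ py) => /iX/(congr1 xX); rewrite !xXK.
have hz : h (z j) = gD (tagged R') by rewrite (hE _ (Pz j)) -eD.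
have hD x y : P y -> gD x = h y -> x = tagged R' /\ y = z j.
  move=> py; rewrite (hE _ py) => /ovD[-> /(congr1 xX)].
  by rewrite /= !xXK.
exists C'; split=> //; exists (h \o z).
exists (fun k x' => if k == j then exists y, x' = gD y else exists2 x, W k x & x' = h x).
exists (fun k s t' => if k == j then exists2 tD, tD \in rel (tag R') s & t' = map_tuple gD tD
   else exists2 t, T k s t & t' = map_tuple h t).
exists (h \o fB); split.
- move=> k; case: (eqVneq k j) => [->|kj].
    by exists gD; split.
  have [f [fi fz w r]] := hp k; exists (h \o f); split.
  + move=> x y /hinj e; apply/fi/e; apply: (PW k) => //; apply/w; by eexists.
  + by rewrite /= fz.
  + move=> x; split=> [[x' /w[y ->] ->]|[y ->]]; first by exists y.
    by exists (f y) => //; apply/w; exists y.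
  + move=> s t; split=> [[t1 /r[t2 h2 ->] ->]|[t' ht ->]].
      by exists t2; rewrite ?map_tuple_comp.
    by exists (map_tuple f t'); rewrite ?map_tuple_comp //; apply/r; exists t'.
- split.
  + by move=> x y /hinj e; apply/iB/e.
  + by rewrite /= e0.
  + move=> k y /=; case: (eqVneq k j) => [->|kj].
      move=> [x /esym/hD[//|_ ey]].
      have : W j (fB y) by rewrite ey; apply/fjW; exists (tagged (E j)).
      by move=> /ov[-> ->].
    move=> [x wx] /hinj e; have ex : fB y = x by apply: e => //; apply: PW wx.
    by move: wx; rewrite -ex => /ov[-> ->].
- move=> k l x; case: (eqVneq k j) => [->|kj]; case: (eqVneq l j) => [->|lj] //.
  + move=> [y ->] [x' wl /hD[]]; first exact: PW wl.
    move=> _ ex; apply: dj wl; rewrite ex; apply/fjW; by exists (tagged (E j)).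
  + move=> [x' wl ->] [y /esym /hD[]]; first exact: PW wl.
    move=> _ ex; apply: (dj _ _ _ wl); rewrite ex; apply/fjW; by exists (tagged (E j)).
  + move=> [x1 w1 ->] [x2 w2 /hinj e]; apply: (dj _ _ _ w1).
    by rewrite e //; [apply: PW w1|apply: PW w2].
- move=> x'; case: (covD x') => [[y ->]|[y ->]].
    by left; exists j; rewrite eqxx; exists y.
  case: (cov (xX y)) => [[k wk]|[b eb]].
    case: (eqVneq k j) wk => [->|kj] wk.
      have ey : xX y = z j by case/asboolP: (PxX y).
      left; exists j; rewrite eqxx; exists (tagged R').
      by rewrite -hz -ey hX'.
    by left; exists k; rewrite (negPf kj); exists (xX y); rewrite // hX'.
  by right; exists b; rewrite /= -eb hX'.
- move=> s t; rewrite RD; split.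
    case=> [hd|[t' /RX rt ->]].
      by apply: Or31; exists j; rewrite eqxx.
    have et : map_tuple gX t' = map_tuple h (map_tuple xX t').
      by rewrite map_tuple_comp; apply: eq_map_tuple => l; rewrite /= hX'.
    rewrite et; case: rt => [[k kj tk]|[tB hB ->]|[t0 eb ->]].
    + by apply: Or31; exists k; rewrite (negPf kj); eexists; first exact: tk.
    + by apply: Or32; exists tB; rewrite ?map_tuple_comp.
    + by apply: Or33; exists t0; rewrite ?map_tuple_comp.
  have rest t1 : Rest s t1 -> exists2 t', t' \in rel X s & map_tuple h t1 = map_tuple gX t'.
    move=> /lift[t' ht ->]; exists t' => //.
    by rewrite map_tuple_comp; apply: eq_map_tuple => l; rewrite /= hX'.
  case=> [[k]|[tB hB ->]|[t0 eb ->]].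
  + case: (eqVneq k j) => [_|kj]; first by left.
    by move=> [t1 tk ->]; right; apply: rest; apply: Or31; exists k.
  + by right; rewrite -map_tuple_comp; apply: rest; apply: Or32; exists tB.
  + by right; rewrite -map_tuple_comp; apply: rest; apply: Or33; exists t0.
Qed.

(** The pieces are exchanged one at a time, by induction on the list of indices already exchanged;
    the hybrids in between mix both families. *)
Lemma sb_leres D D' : forest (tag B) -> (forall k, leres O (D k) (D' k)) ->
  residual O (sb beta D i) B -> residual O (sb beta D' i) B.
Proof.
move=> fB le /hyb_of_residual h; apply: residual_of_hyb.
have {h} : hyb (fun k => if k \in enum 'I_n then D' k else D k).
  elim: (enum 'I_n) => [|j l IH]; first exact: h.
  have [jl|jl] := boolP (j \in l).
    by congr hyb: IH; apply: funext => k; rewrite inE; case: eqVneq => // ->; rewrite jl.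
  have := hyb_replace (j := j) (R' := D' j) fB _ IH.
  rewrite (negPf jl) => /(_ (le j)); congr hyb; apply: funext => k.
  by rewrite inE; case: eqVneq => // ->.
by congr hyb; apply: funext => k; rewrite mem_enum.
Qed.

End Congruence.

(** * Targets and their amalgams *)

Section Targets.
Variables (S : finType) (ar : S -> nat) (L : finType).
Notation struct := (struct ar).
Notation rstruct := (rstruct ar).
Notation V A := 'I_(nv A).
Local Notation rel := Defs.rel.

Record target := Target {
  tv : Type;
  tr : forall s : S, (ar s).-tuple tv -> Prop;
  lab : tv -> option L
}.

(** The points of the amalgam are encoded as pairs of options, which avoids a quotient: unlabelled
    points occur alone, labelled ones only in pairs with equal label. *)
Definition fits (X Y : target) (ox : option (tv X)) (oy : option (tv Y)) : Prop :=
  match ox, oy with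
  | Some x, None => lab x = None
  | None, Some y => lab y = None
  | Some x, Some y => lab x = lab y /\ lab x <> None
  | None, None => False
  end.

Definition typed (D : struct) (X : target) (f : V D -> option (tv X)) s
    (t : (ar s).-tuple (V D)) :=
  exists2 tx, tr tx & map_tuple f t = map_tuple Some tx.

(* A homomorphism from D to the amalgam of X and Y in which a labelled point of
   X is identified with every point of Y carrying the same label. *)
Definition joint (X Y : target) (D : struct)
    (f : V D -> option (tv X)) (g : V D -> option (tv Y)) :=
  (forall x, fits (f x) (g x)) /\
  forall s (t : (ar s).-tuple _), t \in rel D s -> typed f t \/ typed g t.

Lemma fits_sym X Y (ox : option (tv X)) (oy : option (tv Y)) : fits ox oy -> fits oy ox.
Proof. by case: ox oy => [x|] [y|] //= [<-]. Qed.

Lemma joint_sym X Y D (f : V D -> option (tv X)) (g : V D -> option (tv Y)) :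
  joint f g -> joint g f.
Proof.
by move=> [h1 h2]; split=> [x|s t /h2[]]; [apply: fits_sym|right|left].
Qed.

Variables (O : struct -> Prop) (m : nat) (P : 'I_m -> rstruct -> Prop).
Hypothesis O_forest : forall A, O A -> forest A.
Local Notation M := 'I_m.

Definition accepts (X Y : target) :=
  exists2 C, O C & exists f g, @joint X Y C f g.

Lemma accepts_sym X Y : accepts X Y -> accepts Y X.
Proof. by move=> [C OC [f [g /joint_sym j]]]; exists C => //; exists g, f. Qed.

(** A relation and not a function: several indices may describe the same residual, and only forests
    are certain to have a class. *)
Definition cls (D : rstruct) (c : M) :=
  forall B : rstruct, forest (tag B) -> (P c B <-> residual O D B).

Lemma cls_leres D D' c : cls D c -> cls D' c -> leres O D D'.
Proof. by move=> h h' B fB /(h B fB) /(h' B fB). Qed.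

Lemma cls_riso D D' c : riso D D' -> cls D c -> cls D' c.
Proof.
move=> i h B fB; rewrite (h B fB); split; apply: riso_residual => //.
exact: riso_sym.
Qed.

Lemma cls_sb n beta (D D' : 'I_n -> rstruct) (mm : 'I_n -> M) i c :
  (forall j, cls (D j) (mm j)) -> (forall j, cls (D' j) (mm j)) ->
  cls (sb beta D i) c -> cls (sb beta D' i) c.
Proof.
move=> h h' hc B fB; rewrite (hc B fB).
by split; apply: sb_leres => // j; apply: cls_leres.
Qed.

Definition block_ok n (X : target) (N : {set S})
    (beta : option {s : S & (ar s).-tuple 'I_n}) (x : 'I_n -> tv X) :=
  match beta with
  | None => True
  | Some b => tr (map_tuple x (tagged b)) \/ (ar (tag b) = 0 /\ tag b \in N)
  end.

(* [gen h x c]: some rooted forest of class c maps to the amalgam with its root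
   over x. Z, Zf and N record what the other target offers: classes of rooted
   forests that may be hung at a labelled point, classes of forests that may be
   added disjointly, and nullary relations. For h = true nothing of the other
   side hangs at the root itself. *)
Inductive gen (X : target) (Z : {set L * M}) (Zf : {set M}) (N : {set S}) :
    bool -> tv X -> M -> Prop :=
| gen_base (h : bool) x c : (lab x = None <-> h = false) -> cls (dot ar) c ->
    gen Z Zf N h x c
| gen_hang x l c : lab x = Some l -> (l, c) \in Z -> gen Z Zf N false x c
| gen_sb h n beta (D : 'I_n -> rstruct) (x : 'I_n -> tv X) (mm : 'I_n -> M) i c :
    gen Z Zf N h (x i) (mm i) ->
    (forall j, j != i -> gen Z Zf N false (x j) (mm j)) ->
    (forall j, cls (D j) (mm j)) -> block_ok N beta x ->
    cls (sb beta D i) c -> gen Z Zf N h (x i) c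
| gen_float h x (D : 'I_2 -> rstruct) c0 c1 c :
    gen Z Zf N h x c0 -> c1 \in Zf -> cls (D ord0) c0 -> cls (D ord_max) c1 ->
    cls (sb None D ord0) c -> gen Z Zf N h x c.

Definition param := ({set L * M} * {set M} * {set S})%type.

Definition nullary (X : target) : {set S} :=
  [set s | `[< ar s = 0 /\ exists t, @tr X s t >]].

Definition effect (X : target) : {ffun param -> param} :=
  [ffun z => ([set lc | `[< exists2 x, lab x = Some lc.1 & @gen X z.1.1 z.1.2 z.2 true x lc.2 >]],
              [set c | `[< exists x, @gen X z.1.1 z.1.2 z.2 false x c >]],
              nullary X)].

Section Realize.
Variables X Y : target.

Definition real (ox : option (tv X)) (oy : option (tv Y)) (c : M) :=
  exists2 D, cls D c & exists f g, [/\ @joint X Y (tag D) f g,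
     f (tagged D) = ox & g (tagged D) = oy].

(** The order of quantifiers reflects that [gen_hang] knows only the label of the point where it
    hangs a piece: one [y] has to serve every [x] with that label. *)
Definition hangable : {set L * M} :=
  [set lc | `[< exists2 y : tv Y, lab y = Some lc.1 &
     forall x : tv X, lab x = Some lc.1 -> real (Some x) (Some y) lc.2 >]].

Definition floatable : {set M} :=
  [set c | `[< exists (y : tv Y) ox, real ox (Some y) c >]].

(** The pieces [D j] themselves need not map anywhere: each is replaced by a realizer of the same
    class, and [cls_sb] keeps the class of the sum. *)
Lemma real_sb n beta (D : 'I_n -> rstruct) (ox : 'I_n -> option (tv X))
    (oy : 'I_n -> option (tv Y)) (mm : 'I_n -> M) i c :
  (forall j, real (ox j) (oy j) (mm j)) ->
  (forall j, cls (D j) (mm j)) ->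
  (forall b, beta = Some b ->
     (exists2 tx, tr tx & map_tuple ox (tagged b) = map_tuple Some tx) \/
     (exists2 ty, tr ty & map_tuple oy (tagged b) = map_tuple Some ty)) ->
  cls (sb beta D i) c -> real (ox i) (oy i) c.
Proof.
move=> hr hD hb hc.
have {}hr j : exists E : {D' : rstruct & {f : V (tag D') -> option (tv X) & V (tag D') -> option (tv Y)}},
    [/\ cls (tag E) (mm j), joint (tag (tagged E)) (tagged (tagged E)),
        tag (tagged E) (tagged (tag E)) = ox j & tagged (tagged E) (tagged (tag E)) = oy j].
  have [D' h1 [f [g [h2 h3 h4]]]] := hr j.
  by exists (existT _ D' (existT _ f g)).
have {hr}[E hE] := choice hr.
pose D' j := tag (E j).
pose f (p : sb_point D') := tag (tagged (E (tag p))) (tagged p).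
pose g (p : sb_point D') := tagged (tagged (E (tag p))) (tagged p).
exists (sb beta D' i); first by apply: cls_sb hc => // j; have [] := hE j.
exists (f \o @mk_out _ _ _ _), (g \o @mk_out _ _ _ _); split.
- split=> [x|s t /mk_rel ht].
    have [_ [h _] _ _] := hE (tag (mk_out x)); exact: h.
  suff: (exists2 tx, tr tx & map_tuple f (map_tuple (@mk_out _ _ _ _) t) = map_tuple Some tx) \/
        (exists2 ty, tr ty & map_tuple g (map_tuple (@mk_out _ _ _ _) t) = map_tuple Some ty).
    by case=> [[tx h1 h2]|[tx h1 h2]]; [left|right]; exists tx => //; rewrite -h2 map_tuple_comp.
  case: ht => [[k [tk htk e]]|[t0 eb e]]; rewrite e.
    have [_ [_ h] _ _] := hE k; rewrite !map_tuple_comp.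
    by case: (h _ _ htk) => h'; [left|right].
  case: (hb _ eb) => [[tx h1 h2]|[tx h1 h2]]; [left|right]; exists tx => //;
    rewrite -h2 map_tuple_comp; apply: eq_map_tuple => j; by have [] := hE (tnth t0 j).
- by rewrite /= mk_inK; have [] := hE i.
- by rewrite /= mk_inK; have [] := hE i.
Qed.

Lemma real_one ox oy c : fits ox oy -> cls (dot ar) c -> real ox oy c.
Proof.
move=> h hc; exists (dot ar) => //; exists (fun=> ox), (fun=> oy).
by split=> //; split=> // s t; rewrite inE.
Qed.

(** For [h = true] nothing of [Y] hangs at the root, so the root can be paired with any [y] of its
    label; this is the uniformity that [hangable] asks for in the opposite direction. For
    [h = false] a hung piece dictates [y]. *)
Lemma gen_real h x c : @gen X hangable floatable (nullary Y) h x c ->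
  if h then forall y, fits (Some x) (Some y) -> real (Some x) (Some y) c
  else exists2 oy, fits (Some x) oy & real (Some x) oy c.
Proof.
elim=> {h x c} [h x c hl hc|x l c hl|h n beta D x mm i c _ IH _ IHj hD hb hc|
  h x D c0 c1 c _ IH].
- case: h hl => hl; last by exists None; [apply/hl|apply: real_one => //; apply/hl].
  by move=> y fy; apply: real_one.
- rewrite inE => /asboolP[y ly hy]; exists (Some y); first by rewrite /= hl ly.
  exact: hy.
- have step oy : fits (Some (x i)) oy -> real (Some (x i)) oy (mm i) -> real (Some (x i)) oy c.
    move=> fo ro.
    have /choice[oz hoz] j : exists oz, [/\ fits (Some (x j)) oz, real (Some (x j)) oz (mm j)
       & j = i -> oz = oy].
      have [ji|ji] := eqVneq j i; first by exists oy; rewrite ji.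
      by have [oz] := IHj j ji; exists oz; split=> // /eqP; rewrite (negPf ji).
    have [_ _ /(_ erefl) <-] := hoz i.
    apply: (real_sb (mm := mm) (ox := Some \o x)) hc => // [j|b eb].
      by have [] := hoz j.
    move: hb; rewrite eb => -[hb|[a0 /[!inE]/asboolP[_ [ty hty]]]].
      by left; eexists; first exact: hb; rewrite map_tuple_comp.
    right; exists ty => //; by apply: eq_from_tnth => l; have := ltn_ord l; rewrite [X in _ < X]a0.
  case: (h) IH => [IH y fy|[oy fo ro]]; first by apply: step => //; apply: IH.
  by exists oy => //; apply: step.
- rewrite inE => /asboolP[y [ox ry]] h0 h1 hc.
  have step oy : real (Some x) oy c0 -> real (Some x) oy c.
    move=> ro.
    pose pk T (a b : T) (j : 'I_2) := if j == ord0 then a else b.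
    have cs Q : Q ord0 -> Q ord_max -> forall j : 'I_2, Q j.
      move=> q0 q1 j; have [->|j0] := eqVneq j ord0; first exact: q0.
      by rewrite (_ : j = ord_max) //; apply: val_inj; case: j j0 => [[|[|]]].
    apply: (real_sb (mm := pk _ c0 c1) (ox := pk _ (Some x) ox)
      (oy := pk _ oy (Some y)) (D := D) (beta := None) (i := ord0)) => //; exact: cs.
  case: (h) IH => [IH y' fy|[oy fo ro]]; first by apply: step; apply: IH.
  by exists oy => //; apply: step.
Qed.

End Realize.

End Targets.

(** * Decomposition of forests *)

Section Acyclic.
Variables (S : finType) (ar : S -> nat).
Notation struct := (struct ar).
Notation rstruct := (rstruct ar).
Notation V A := 'I_(nv A).
Local Notation rel := Defs.rel.
Local Notation blk A := {s : S & (ar s).-tuple 'I_(nv A)}.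

Definition blocks (C : struct) : {set blk C} := [set b | tagged b \in rel C (tag b)].

Section Adj.
Variable C : struct.
Implicit Types (E : {set blk C}) (b c : blk C) (x y z : V C).

Definition adj E x y := [exists b in E, (x \in tagged b) && (y \in tagged b)].

Lemma adjI E b x y : b \in E -> x \in tagged b -> y \in tagged b -> adj E x y.
Proof. by move=> bE xb yb; apply/existsP; exists b; rewrite bE xb. Qed.

Lemma adj_sym E : symmetric (adj E).
Proof.
by move=> x y; apply: eq_existsb => b; rewrite [(x \in _) && _]andbC.
Qed.

Lemma connect_adj_sym E : connect_sym (adj E).
Proof. exact/sym_connect_sym/adj_sym. Qed.

Lemma connect_block E b x y : b \in E -> x \in tagged b -> y \in tagged b ->
  connect (adj E) x y.
Proof. by move=> bE xb yb; apply/connect1/(adjI bE). Qed.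

Lemma connect_adjS E E' x y : E \subset E' ->
  connect (adj E) x y -> connect (adj E') x y.
Proof.
move=> sub; apply: connect_sub => {}x {}y /existsP[b /and3P[bE xb yb]].
exact: connect_block (subsetP sub _ bE) xb yb.
Qed.

Lemma connect_ind E (Q : V C -> Prop) x :
  Q x -> (forall y z, connect (adj E) x y -> Q y -> adj E y z -> Q z) ->
  forall y, connect (adj E) x y -> Q y.
Proof.
move=> q0 qS y /connectP[p]; elim/last_ind: p y => [|p z IH] y /=; first by move=> _ ->.
rewrite rcons_path last_rcons => /andP[pp az] ->.
apply: qS az; [by apply/connectP; exists p | exact: IH].
Qed.

(** Cut the walk just before its first use of [b]; the vertex reached there lies in [b]. *)
Lemma connect_avoid E b v z : connect (adj E) v z ->
  connect (adj (E :\ b)) v z \/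
  exists2 x, x \in tagged b & connect (adj (E :\ b)) v x.
Proof.
move: z; apply: connect_ind => [|y z _ IH /existsP[b' /and3P[b'E yb zb]]]; first by left.
case: IH => [c|]; last by right.
have [e|nb] := eqVneq b' b; first by right; exists y => //; rewrite -e.
by left; apply: connect_trans c _; apply: connect_block yb zb; rewrite !inE nb.
Qed.

(** A path of [adj] does not show its blocks and may use one of them twice; a simple path in the
    incidence graph has distinct vertices and distinct blocks. *)
Definition inc E (p q : V C + blk C) :=
  match p, q with
  | inl x, inr b | inr b, inl x => (b \in E) && (x \in tagged b)
  | _, _ => false
  end.

Definition getl (p : V C + blk C) := if p is inl x then Some x else None.
Definition getr (p : V C + blk C) := if p is inr b then Some b else None.

Lemma inc_chain E c p x y : path (inc E) (inl x) p -> last (inl x) p = inl y ->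
  let xs := pmap getl (inl x :: p) in let bs := pmap getr p in
  [/\ size xs = (size bs).+1, nth x xs (size bs) = y &
    forall i, i < size bs -> [/\ nth c bs i \in E, nth x xs i \in tagged (nth c bs i)
       & nth x xs i.+1 \in tagged (nth c bs i)]].
Proof.
(* One step of the chain consumes two entries of the path, hence the induction on a bound of its
   size. *)
have [k] := ubnP (size p); elim: k p x => // k IH [|[x1|b] [|[x'|b'] p]] x //=.
- by move=> _ _ [->].
- move=> szp; rewrite -!andbA => /and5P[bE xb _ xb' pp] e.
  have [|s1 s2 s3] := IH p x' _ pp e; first by rewrite -ltnS ltnW.
  rewrite /= in s1 s2 s3 *; case: s1 => s1; rewrite s1; split=> //.
    rewrite -s2; apply: set_nth_default; by rewrite /= s1.
  case=> [|i] //= ib; have [h1 h2 h3] := s3 i ib.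
  have sz : i.+1 < size (x' :: pmap getl p) by rewrite /= s1.
  split=> //; first by rewrite (set_nth_default x') // ltnW.
  by rewrite (set_nth_default x') // -[size _]/(size (x' :: pmap getl p)).-1 -ltnS s1.
- by rewrite andbF.
Qed.

Lemma connect_inc E x y : connect (adj E) x y -> connect (inc E) (inl x) (inl y).
Proof.
move: y; apply: connect_ind => [|y z _ h /existsP[b /and3P[bE yb zb]]]; first exact: connect0.
apply: connect_trans h _; apply: (@connect_trans _ _ (inr b)); apply: connect1;
  by rewrite /= bE.
Qed.

(** Otherwise a simple path from [x] to [y] closes up through [c] to a cycle, whose blocks are
    distinct because [c] is not in [E]. *)
Lemma forest_acyclic E c x y : forest C -> E \subset blocks C -> c \in blocks C ->
  c \notin E -> x \in tagged c -> y \in tagged c -> connect (adj E) x y -> x = y.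
Proof.
move=> [_ nocyc] EC cC cE xc yc /connect_inc/connectP[p0 pp0 l0].
have [//|xy] := eqVneq x y; case: nocyc.
case/shortenP: pp0 l0 => p pp up _ /esym lp.
have := inc_chain c pp lp; set xs := pmap _ _; set bs := pmap _ _ => -[s1 s2 s3].
have uxs : uniq xs by apply: pmap_uniq up => -[].
have ubs : uniq (rcons bs c).
  rewrite rcons_uniq; apply/andP; split.
    apply/negP => /(nthP c)[i /s3[bE _ _] e]; by rewrite e (negPf cE) in bE.
  by case/andP: up => _; apply: pmap_uniq; case.
have s0 : nth x xs 0 = x by [].
clearbody xs bs; exists (size xs), (fun i => nth x xs i), (fun i => nth c (rcons bs c) i); split.
- rewrite s1 ltnS lt0n; apply/eqP => b0; by move: s2 xy; rewrite b0 s0 => ->; rewrite eqxx.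
- by move=> i j /eqP; rewrite nth_uniq // => /eqP/val_inj.
- move=> i j /eqP; rewrite nth_uniq ?size_rcons -?s1 // => /eqP/val_inj //.
- move=> [i /= hi]; rewrite nth_rcons; move: (hi); rewrite {1}s1 ltnS leq_eqVlt.
  case/orP => [/eqP ei|ib].
    (* The last block is [c], and there the cyclic successor wraps around to [x]. *)
    rewrite ei ltnn eqxx s2 s1 modnn s0; split=> //; by rewrite inE in cC.
  have [bE h1 h2] := s3 i ib; rewrite ib; split=> //.
    by move/subsetP: EC => /(_ _ bE); rewrite inE.
  by rewrite s1 modn_small.
Qed.

End Adj.
End Acyclic.

Section Peel.
Variables (S : finType) (ar : S -> nat).
Notation struct := (struct ar).
Notation rstruct := (rstruct ar).
Notation V A := 'I_(nv A).
Local Notation rel := Defs.rel.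
Local Notation blk A := {s : S & (ar s).-tuple 'I_(nv A)}.

(** Comparing both structures inside an ambient type spares the explicit bijection. *)
Lemma riso_common (X : Type) (D D' : rstruct) (u : V (tag D) -> X) (v : V (tag D') -> X) :
  injective u -> injective v -> (forall x, exists y, u x = v y) ->
  (forall y, exists x, u x = v y) -> u (tagged D) = v (tagged D') ->
  (forall s (t : (ar s).-tuple _) (t' : (ar s).-tuple _), map_tuple u t = map_tuple v t' ->
     t \in rel (tag D) s <-> t' \in rel (tag D') s) ->
  riso D D'.
Proof.
move=> ui vi /choice[e he] /choice[e' he'] er eR; exists e; split.
- exists e' => [x|y]; first by apply: ui; rewrite he' he.
  by apply: vi; rewrite -he he'.
- by apply: vi; rewrite -he.
- move=> s t; apply: eR; rewrite map_tuple_comp; exact: eq_map_tuple.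
Qed.

Variable C : struct.
Implicit Types (W : {set V C}) (E : {set blk C}).

(** Adding [d] to [W] provides the root without a membership proof. The blocks are prescribed by
    [E], since the induction on forests sometimes removes a block and keeps all vertices. *)
Definition subr W E (d : V C) : rstruct := existT _
  (mk (fun s (t : (ar s).-tuple {x | x \in d |: W}) => Tagged _ (map_tuple val t) \in E))
  (mk_in _ (exist _ d (setU11 d W))).

Definition sub_val W E d (x : V (tag (subr W E d))) : V C := val (mk_out x).

Lemma sub_val_inj W E d : injective (@sub_val W E d).
Proof. by move=> x y /val_inj /(can_inj (mk_outK (R := _))). Qed.

Lemma sub_val_root W E d : sub_val (tagged (subr W E d)) = d.
Proof. by rewrite /sub_val mk_inK. Qed.

Lemma sub_val_in W E d x : d \in W -> @sub_val W E d x \in W.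
Proof.
by move=> dW; rewrite /sub_val; case: (mk_out x) => y /=; rewrite !inE => /orP[/eqP->|].
Qed.

Lemma sub_val_surj W E d x : x \in W -> exists y, @sub_val W E d y = x.
Proof.
move=> xW; have xW' : x \in d |: W by rewrite inE xW orbT.
by exists (mk_in _ (exist _ x xW')); rewrite /sub_val mk_inK.
Qed.

Lemma sub_rel W E d s (t : (ar s).-tuple (V (tag (subr W E d)))) :
  t \in rel _ s <-> Tagged _ (map_tuple (@sub_val W E d) t) \in E.
Proof. by rewrite mk_rel map_tuple_comp. Qed.

Lemma sub_forest W E d : forest C -> E \subset blocks C -> forest (tag (subr W E d)).
Proof.
move=> fC EC; apply: forest_inj_hom (@sub_val_inj W E d) _ fC => s t /sub_rel.
by move/(subsetP EC); rewrite inE.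
Qed.

Lemma sub_sb n (beta : option {s : S & (ar s).-tuple 'I_n}) W E
    (W_ : 'I_n -> {set V C}) (E_ : 'I_n -> {set blk C}) (z : 'I_n -> V C) i :
  (forall k, z k \in W_ k) ->
  (forall k l x, x \in W_ k -> x \in W_ l -> k = l) ->
  (forall x, x \in W <-> exists k, x \in W_ k) ->
  (forall b, b \in E <-> (exists k, b \in E_ k) \/
     exists2 b0, beta = Some b0 & b = existT _ (tag b0) (map_tuple z (tagged b0))) ->
  (forall k b x, b \in E_ k -> x \in tagged b -> x \in W_ k) ->
  riso (subr W E (z i)) (sb beta (fun k => subr (W_ k) (E_ k) (z k)) i).
Proof.
move=> zW dj cov hE EW; set D := fun k => subr _ _ _.
pose v (p : V (tag (sb beta D i))) := sub_val (tagged (mk_out p)).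
have zW' : z i \in W by apply/cov; exists i.
have Wv p : v p \in W_ (tag (mk_out p)) by apply: sub_val_in.
have tagv p k : v p \in W_ k -> tag (mk_out p) = k by apply: dj.
apply: (riso_common (u := @sub_val W E (z i)) (v := v)).
- exact: sub_val_inj.
- move=> p q e; apply: (can_inj (mk_outK (R := _))).
  have ek : tag (mk_out p) = tag (mk_out q) by apply: tagv; rewrite e.
  move: e ek; rewrite /v; case: (mk_out p) (mk_out q) => [k x] [l y] /= e ek.
  by subst l; congr existT; apply: sub_val_inj e.
- move=> x; have /cov[k] := sub_val_in x zW'.
  case/(sub_val_surj (E_ k) (z k)) => y <-.
  by exists (mk_in _ (sb_pt (D := D) y)); rewrite /v mk_inK.
- by move=> p; apply: sub_val_surj; apply/cov; exists (tag (mk_out p)).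
- by rewrite sub_val_root /v /= mk_inK sub_val_root.
- move=> s t t' e; rewrite sub_rel e hE mk_rel; split.
  + case=> [[k bk]|[[s0 t0] eb /= e0]].
      left; exists k.
      have [tk htk] : exists tk : (ar s).-tuple (V (tag (D k))), forall l,
         mk_out (tnth t' l) = sb_pt (D := D) (tnth tk l).
        apply: (tuple_choice (P := fun l x => mk_out (tnth t' l) = sb_pt (D := D) x)) => l.
        have /tagv : v (tnth t' l) \in W_ k.
          by apply: EW bk _; rewrite /= -tnth_map mem_tnth.
        by case: (mk_out _) => k' x /= ek; subst k'; exists x.
      have etk : map_tuple (@mk_out _ _ _ _) t' = map_tuple (@sb_pt _ _ _ D k) tk.
        by apply/map_tuple_eqP.
      exists tk => //; apply/sub_rel.
      rewrite (_ : map_tuple _ tk = map_tuple v t') //.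
      by apply/map_tuple_eqP => l; rewrite /v htk.
    have es := congr1 tag e0; rewrite /= in es; subst s0; right; exists t0 => //.
    move/eqP: e0; rewrite -tag_eqE /tag_eq /= eqxx tagged_asE => /eqP/map_tuple_eqP e0.
    apply/map_tuple_eqP => l.
    have {}e0 := e0 l; have ek : tag (mk_out (tnth t' l)) = tnth t0 l.
      by apply: tagv; rewrite e0.
    move: e0 ek; rewrite /v; case: (mk_out _) => k x /= e0 ek; subst k.
    by rewrite /sb_root; congr existT; apply: sub_val_inj; rewrite e0 sub_val_root.
  + case=> [[k [tk /sub_rel h1 h2]]|[t0 eb h2]].
      left; exists k; rewrite (_ : map_tuple v t' = map_tuple (@sub_val _ _ _) tk) //.
      by move/map_tuple_eqP: h2 => h2; apply/map_tuple_eqP => l; rewrite /v h2.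
    right; eexists; first exact: eb.
    congr existT; apply/map_tuple_eqP => l; move/map_tuple_eqP: h2 => h2.
    by rewrite /v h2 /= sub_val_root.
Qed.

Definition wf W E (d : V C) := [/\ d \in W, E \subset blocks C &
  forall b x, b \in E -> x \in tagged b -> x \in W].

(** Once [c] is removed, acyclicity puts its vertices in different components. *)
Lemma peel W E c (i : 'I_(ar (tag c))) : forest C ->
  wf W E (tnth (tagged c) i) -> c \in E ->
  exists (W_ : 'I_(ar (tag c)) -> {set V C}) (E_ : 'I_(ar (tag c)) -> {set blk C}),
  [/\ forall k, wf (W_ k) (E_ k) (tnth (tagged c) k),
      forall k, E_ k \subset E :\ c,
      forall k, W_ k \subset W &
      riso (subr W E (tnth (tagged c) i))
        (sb (Some (Tagged (fun s => (ar s).-tuple 'I_(ar (tag c))) (ord_tuple (ar (tag c)))))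
          (fun k => subr (W_ k) (E_ k) (tnth (tagged c) k)) i)].
Proof.
move=> fC [dW EC EW] cE; set z := tnth (tagged c).
set E' := E :\ c; have E'E : E' \subset E by apply: subsetDl.
have cC := subsetP EC _ cE.
have zW k : z k \in W by apply: EW cE _; apply: mem_tnth.
have zi : injective z.
  by apply/tuple_uniqP; case: fC => np _; apply: np; rewrite inE in cC.
have acyc k l : connect (adj E') (z k) (z l) -> k = l.
  move=> h; apply: zi; apply: (forest_acyclic (E := E') (c := c)) => //.
  - exact: subset_trans EC.
  - by rewrite !inE eqxx.
  - exact: mem_tnth.
  - exact: mem_tnth.
have tr := @connect_trans _ (adj E'); have sy := connect_adj_sym E'.
(* The pieces at the other vertices of [c] are components; the piece at the root takes all the rest,
   including the components that [c] does not meet. *)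
pose W_ k : {set V C} := if k == i then
    [set x in W | [forall j, (j != i) ==> ~~ connect (adj E') (z j) x]]
  else [set x in W | connect (adj E') (z k) x].
(* A block of arity 0 satisfies [all] vacuously and enters every piece, which is harmless because
   the sum takes the union of the blocks. *)
pose E_ k : {set blk C} := [set b in E' | all (mem (W_ k)) (tagged b)].
have WW k x : x \in W_ k -> x \in W by rewrite /W_; case: eqP => _; rewrite inE => /andP[].
have zW_ k : z k \in W_ k.
  rewrite /W_; case: (eqVneq k i) => [->|ki]; rewrite inE zW ?connect0 //=.
  by apply/forallP => j; apply/implyP; apply: contraNN => /acyc ->.
have dj k l x : x \in W_ k -> x \in W_ l -> k = l.
  rewrite /W_; case: (eqVneq k i) => [->|ki]; case: (eqVneq l i) => [->|li];
    rewrite ?inE //.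
  - by case/andP=> _ /forallP/(_ l); rewrite li => /negPf-> /andP[].
  - by move=> /andP[_ h] /andP[_ /forallP/(_ k)]; rewrite ki h.
  - by move=> /andP[_ h] /andP[_ h']; apply: acyc; apply: tr h _; rewrite sy.
have cov x : x \in W <-> exists k, x \in W_ k.
  split=> [xW|[k]]; last exact: WW.
  have [/existsP[j /andP[ji cj]]|no] :=
    boolP [exists j, (j != i) && connect (adj E') (z j) x].
    by exists j; rewrite /W_ (negPf ji) inE xW.
  exists i; rewrite /W_ eqxx inE xW; apply/forallP => j; apply/implyP => ji.
  by apply: contraNN no => cj; apply/existsP; exists j; rewrite ji.
have Wcl k x y : x \in W_ k -> y \in W -> connect (adj E') x y -> y \in W_ k.
  rewrite /W_; case: eqP => _; rewrite !inE => /andP[_ h] -> cxy /=; last exact: tr cxy.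
  apply/forallP => j; move/forallP: h => /(_ j); case: (j != i) => //=.
  by apply: contraNN => h; apply: tr h _; rewrite sy.
have EWk k b x : b \in E_ k -> x \in tagged b -> x \in W_ k.
  by rewrite inE => /andP[_ /allP h] /h.
have ES k : E_ k \subset E' by apply/subsetP => b; rewrite inE => /andP[].
exists W_, E_; split=> [k|k|k|] //.
- split=> //; first by apply: subset_trans (ES k) (subset_trans E'E EC).
  exact: EWk.
- by apply/subsetP => x; apply: WW.
have cz : c = existT _ (tag c) (map_tuple z (ord_tuple (ar (tag c)))).
  rewrite [LHS](_ : c = existT _ (tag c) (tagged c)); last by case: (c).
  by congr existT; apply: eq_from_tnth => l; rewrite tnth_map tnth_ord_tuple.
apply: sub_sb => // b; split.
  move=> bE; have [->|bc] := eqVneq b c.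
    by right; eexists; rewrite ?cz.
  left; have bE' : b \in E' by rewrite !inE bc.
  case et: (tval (tagged b)) => [|x0 l].
    by exists i; rewrite inE bE' et.
  have x0b : x0 \in tagged b by rewrite -[_ \in _]/(x0 \in tval (tagged b)) et mem_head.
  have /cov[k hk] := EW _ _ bE x0b; exists k; rewrite inE bE' /=.
  apply/allP => y yb; apply: Wcl hk _ _; first exact: EW bE yb.
  exact: connect_block bE' x0b yb.
case=> [[k /(subsetP (ES k))/(subsetP E'E) //]|[b0 [<-] ->]] /=.
by rewrite -cz.
Qed.

End Peel.

(** * The amalgam sees only the effect of a target *)

Section Generation.
Variables (S : finType) (ar : S -> nat) (L : finType).
Notation struct := (struct ar).
Notation rstruct := (rstruct ar).
Notation V A := 'I_(nv A).
Local Notation rel := Defs.rel.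
Local Notation blk A := {s : S & (ar s).-tuple 'I_(nv A)}.
Notation target := (target ar L).

Variables (O : struct -> Prop) (m : nat) (P : 'I_m -> rstruct -> Prop).
Hypothesis P_cover : forall D, forest (tag D) -> exists c, cls O P D c.
Local Notation M := 'I_m.
Local Notation cls := (cls O P).
Local Notation param := (param S L m).

(** [zx] is what [X] receives and [zy] what [Y] receives. Any closed pair of offers qualifies, in
    particular one taken from a different pair of targets. *)
Definition saturated (X Y : target) (zx zy : param) :=
  [/\ forall l c x, lab x = Some l -> @gen _ _ _ O _ P X zx.1.1 zx.1.2 zx.2 true x c -> (l, c) \in zy.1.1,
      forall c x, @gen _ _ _ O _ P X zx.1.1 zx.1.2 zx.2 false x c -> c \in zy.1.2,
      nullary X \subset zy.2 & nullary Y \subset zx.2].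

Variable C : struct.
Hypothesis C_forest : forest C.
Implicit Types (W : {set V C}) (E : {set blk C}).

Definition good X (zx : param) (f : V C -> option (tv X)) W E d :=
  forall c x, cls (subr W E d) c -> f d = Some x ->
    @gen _ _ _ O _ P X zx.1.1 zx.1.2 zx.2 false x c.

(** The condition on a root that corresponds to [h = true] in [gen]. *)
Definition pure (X : target) (f : V C -> option (tv X)) E d :=
  forall b, b \in E -> d \in tagged b -> typed f (tagged b).

Definition good_pure X (zx : param) (f : V C -> option (tv X)) W E d :=
  forall c x, cls (subr W E d) c -> f d = Some x -> lab x <> None -> pure f E d ->
    @gen _ _ _ O _ P X zx.1.1 zx.1.2 zx.2 true x c.

Section Step.
Variables (X Y : target) (zx zy : param).
Variables (f : V C -> option (tv X)) (g : V C -> option (tv Y)).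
Hypothesis fg : joint f g.
Hypothesis clXY : saturated X Y zx zy.
Hypothesis clYX : saturated Y X zy zx.
Variables (W : {set V C}) (E : {set blk C}) (d : V C).
Hypothesis wfW : wf W E d.
Hypothesis IH : forall (W' : {set V C}) (E' : {set blk C}) d', wf W' E' d' ->
  #|W'| + #|E'| < #|W| + #|E| ->
  [/\ good zx f W' E' d', good_pure zx f W' E' d' & good zy g W' E' d'].

Local Notation genX := (@gen _ _ _ O _ P X zx.1.1 zx.1.2 zx.2).

Lemma sub_cls W' E' d' : wf W' E' d' -> exists c, cls (subr W' E' d') c.
Proof. by move=> [_ h _]; apply/P_cover/sub_forest. Qed.

(** All pieces left by peeling [b] sit at vertices mapped to [X] and have lost the block [b], so the
    induction hypothesis applies and [gen_sb] reassembles them. Purity is passed on to the root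
    piece only. *)
Lemma gen_peel (h : bool) b c x : b \in E -> d \in tagged b -> typed f (tagged b) ->
  cls (subr W E d) c -> f d = Some x -> (h -> lab x <> None /\ pure f E d) ->
  genX h x c.
Proof.
move=> bE /tnthP[i ei] [tx htx ex] hc fd hh.
have fz k : f (tnth (tagged b) k) = Some (tnth tx k) by move/map_tuple_eqP: ex.
move: hc; rewrite ei => hc.
have wf' := wfW; rewrite ei in wf'.
have [W_ [E_ [wk Ek Wk iso]]] := peel C_forest wf' bE.
have /choice[mm hmm] k : exists c', cls (subr (W_ k) (E_ k) (tnth (tagged b) k)) c'.
  exact: sub_cls (wk k).
have sz k : #|W_ k| + #|E_ k| < #|W| + #|E|.
  rewrite (cardsD1 b E) bE add1n addnS ltnS.
  by apply: leq_add; apply: subset_leq_card.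
have ih k := IH (wk k) (sz k).
have ex' : x = tnth tx i by apply: Some_inj; rewrite -fd ei fz.
rewrite ex'; apply: (gen_sb (mm := mm) (x := tnth tx)
  (D := fun k => subr (W_ k) (E_ k) (tnth (tagged b) k))); last exact: cls_riso iso hc.
- have [h1 h2 _] := ih i; case: (h) hh => [/(_ isT)[lx pu]|_]; last by apply: h1.
  apply: h2 => //; first by rewrite -ex'.
  move=> b' b'E db'; apply: pu; last by rewrite ei.
  by have := subsetP (Ek i) _ b'E; rewrite inE => /andP[].
- by move=> j ji; have [h1 _ _] := ih j; apply: h1.
- exact: hmm.
- left; rewrite (_ : map_tuple _ _ = tx) //.
  by apply: eq_from_tnth => l; rewrite tnth_map tnth_ord_tuple.
Qed.

(** Either a block of arity 0 can be stripped, or the rest can be split off at another vertex [e],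
    or a single point remains. The rest is added by [gen_sb] if [e] maps to [X], and floats in from
    [Y] otherwise. *)
Lemma gen_isolated (h : bool) c x : (forall b, b \in E -> d \notin tagged b) ->
  cls (subr W E d) c -> f d = Some x -> (lab x = None <-> h = false) -> genX h x c.
Proof.
move=> iso hc fd hl; have [dW EC EW] := wfW.
have gh W' E' c' : wf W' E' d -> #|W'| + #|E'| < #|W| + #|E| ->
    (forall b, b \in E' -> d \notin tagged b) -> cls (subr W' E' d) c' -> genX h x c'.
  move=> w' sz i' hc'; have [h1 h2 _] := IH w' sz.
  case: (h) hl => hl; last by apply: h1.
  apply: h2 => //; first by move=> /hl.
  by move=> b /i' /negP h3 /h3.
have [/existsP[b /andP[bE /eqP b0]]|nonul] := boolP [exists b in E, ar (tag b) == 0].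
  have not0 (l : 'I_(ar (tag b))) : False by have := ltn_ord l; rewrite [X in _ < X]b0.
  pose beta : option {s : S & (ar s).-tuple 'I_1} :=
    Some (existT _ (tag b) (map_tuple (fun=> ord0) (tagged b))).
  have w' : wf W (E :\ b) d.
    split=> //; first by apply: subset_trans EC; apply: subsetDl.
    by move=> b' y; rewrite inE => /andP[_]; apply: EW.
  have [c' hc'] := sub_cls w'.
  have ri : riso (subr W E d) (sb beta (fun k => subr W (E :\ b) d) ord0).
    apply: (@sub_sb _ _ _ _ beta W E (fun=> W) (fun=> E :\ b) (fun=> d) ord0) => //.
    - by move=> k l _ _ _; rewrite !ord1.
    - by move=> y; split=> [yW|[]//]; exists ord0.
    - have eb : b = existT _ (tag b) (map_tuple (fun=> d) (map_tuple (fun=> ord0 : 'I_1) (tagged b))).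
        rewrite [LHS](_ : b = existT _ (tag b) (tagged b)); last by case: (b).
        by congr existT; apply: eq_from_tnth => l; case: (not0 l).
      move=> b'; split.
        move=> b'E; have [->|nb] := eqVneq b' b; last by left; exists ord0; rewrite !inE nb.
        by right; eexists; first by reflexivity.
      by case=> [[_ /setD1P[]]|[b1 [<-] ->]] //=; rewrite -eb.
    - by move=> _ b' y /setD1P[_]; apply: EW.
  apply: (@gen_sb _ _ _ O _ P X _ _ _ h 1 beta (fun k => subr W (E :\ b) d) (fun=> x) (fun=> c') ord0).
  - apply: gh hc' => //; first by rewrite (cardsD1 b E) bE add1n addnS.
    by move=> b' /setD1P[_]; apply: iso.
  - by move=> j; rewrite ord1.
  - by [].
  - have bC : tagged b \in rel C (tag b) by move/subsetP: EC => /(_ b bE); rewrite inE.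
    case: (fg.2 _ _ bC) => [[tx h1 _]|[ty h1 _]]; [left|right].
      rewrite /= (_ : map_tuple _ _ = tx) //.
      by apply: eq_from_tnth => l; case: (not0 l).
    split=> //; case: clXY => _ _ _ /subsetP; apply; rewrite inE; apply/asboolP.
    by split=> //; exists ty.
  - exact: cls_riso ri hc.
have [/existsP[e /andP[eW ed]]|noe] := boolP [exists e in W, e != d].
  pose pk T (p q : T) (j : 'I_2) := if j == ord0 then p else q.
  have pkP (Q : 'I_2 -> Prop) : Q ord0 -> Q ord_max -> forall j, Q j.
    move=> q0 q1 j; have [->|j0] := eqVneq j ord0; first exact: q0.
    by rewrite (_ : j = ord_max) //; apply: val_inj; case: j j0 => [[|[|]]].
  have w0 : wf [set d] set0 d.
    by split; [rewrite inE | exact: sub0set | move=> b y; rewrite inE].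
  have w1 : wf (W :\ d) E e.
    split=> //; first by rewrite !inE ed.
    move=> b y bE yb; rewrite !inE (EW _ _ bE yb) andbT.
    by apply: contraNneq (iso _ bE) => <-.
  have [c0 hc0] := sub_cls w0; have [c1 hc1] := sub_cls w1.
  pose W_ := pk _ [set d] (W :\ d); pose E_ := pk _ (set0 : {set blk C}) E; pose z := pk _ d e.
  pose D k := subr (W_ k) (E_ k) (z k).
  have ri : riso (subr W E d) (sb None D ord0).
    apply: (@sub_sb _ _ _ _ None W E W_ E_ z ord0).
    - by apply: (pkP); rewrite ?inE ?ed.
    - by move=> k l y; move: k l; apply: (pkP); apply: (pkP) => //; rewrite !inE;
        case: eqVneq.
    - move=> y; split=> [yW|[k]].
        have [yd|yd] := eqVneq y d; [exists ord0|exists ord_max]; rewrite !inE ?yd //.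
      by move: k; apply: (pkP); rewrite !inE; [move=> /eqP->|case/andP].
    - move=> b; split=> [bE|[[k]|[]//]]; first by left; exists ord_max.
      by move: k; apply: (pkP); rewrite ?inE.
    - by move=> k b y; move: k; apply: (pkP); [rewrite inE|case: w1 => _ _; apply].
  have eW2 : #|W| = #|W :\ d|.+1 by rewrite (cardsD1 d) dW.
  have s0 : #|[set d]| + #|(set0 : {set blk C})| < #|W| + #|E|.
    by rewrite cards1 cards0 eW2 (cardsD1 e (W :\ d)) !inE ed eW.
  have s1 : #|W :\ d| + #|E| < #|W| + #|E| by rewrite eW2.
  have g0 : genX h x c0 by apply: gh hc0 => // b; rewrite inE.
  have [h1 _ h3] := IH w1 s1.
  have := fg.1 e; case ef : (f e) => [x'|]; last case eg : (g e) => [y|//] _.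
    move=> _; apply: (@gen_sb _ _ _ O _ P X _ _ _ h 2 None D (pk _ x x') (pk _ c0 c1) ord0) => //.
    - by apply: (pkP) => // _; apply: h1.
    - exact: pkP.
    - exact: cls_riso ri hc.
  apply: (gen_float (D := D) (c0 := c0) (c1 := c1)) => //; last exact: cls_riso ri hc.
  by case: clYX => _ h4 _ _; apply: h4; apply: h3 hc1 eg.
apply: gen_base => //; apply: cls_riso hc.
have Wd y : y \in W -> y = d.
  by move=> yW; apply: contraNeq noe => yd; apply/existsP; exists y; rewrite yW.
have E0 b : b \in E -> False.
  move=> bE; have b0 : ar (tag b) != 0.
    by apply: contraNneq nonul => b0; apply/existsP; exists b; rewrite bE b0 eqxx.
  have l : 'I_(ar (tag b)) by case: (ar (tag b)) b0 => // n _; exact: ord0.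
  have yb := mem_tnth l (tagged b); have ed := Wd _ (EW _ _ bE yb).
  by have := iso _ bE; rewrite -{1}ed yb.
apply: (riso_common (u := @sub_val _ _ C W E d) (v := fun=> d)).
- exact: sub_val_inj.
- by move=> y y' _; rewrite !ord1.
- by move=> y; exists ord0; apply: Wd; apply: sub_val_in.
- by move=> _; exists (tagged (subr W E d)); rewrite sub_val_root.
- exact: sub_val_root.
- by move=> s t t' _; split=> [/sub_rel/E0 //|]; rewrite inE.
Qed.

Lemma good_pure_step : good_pure zx f W E d.
Proof.
move=> c x hc fd lx pu.
have [/existsP[b /andP[bE db]]|no] := boolP [exists b in E, d \in tagged b].
  by apply: gen_peel bE db (pu _ bE db) hc fd _.
apply: gen_isolated hc fd _; last by split.
by move=> b bE; apply: contraNN no => db; apply/existsP; exists b; rewrite bE.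
Qed.

(** If no block at [d] lifts to [X], all of them lift to [Y]. Then either [d] is a labelled point
    and the whole forest hangs there from the side of [Y], its class being on offer by saturation,
    or [d] has no block at all. *)
Lemma good_step : good_pure zy g W E d -> good zx f W E d.
Proof.
move=> gp c x hc fd; have [dW EC EW] := wfW.
have [[b bE [db tb]]|notyp] :=
    pselect (exists2 b, b \in E & d \in tagged b /\ typed f (tagged b)).
  by apply: gen_peel bE db tb hc fd _.
have ty : pure g E d.
  move=> b bE db; have bC : tagged b \in rel C (tag b) by move/subsetP: EC => /(_ b bE); rewrite inE.
  by case: (fg.2 _ _ bC) => // tf; case: notyp; exists b.
have := fg.1 d; rewrite fd; case eg: (g d) => [y|] /= fdg.
  have [ly lx] := fdg; case el : (lab x) lx => [l|//] _.
  have el1 := el; apply: gen_hang el1 _; case: clYX => h _ _ _; apply: (h l c y); first by rewrite -ly el.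
  by apply: gp => //; rewrite -ly el.
apply: gen_isolated hc fd _; last by [].
move=> b bE; apply/negP => db; have [ty' _ e] := ty _ bE db.
by case/tnthP: db => i ei; move/map_tuple_eqP: e => /(_ i); rewrite -ei eg.
Qed.

End Step.

Lemma good_all X Y zx zy (f : V C -> option (tv X)) (g : V C -> option (tv Y)) :
  joint f g -> saturated X Y zx zy -> saturated Y X zy zx ->
  forall W E d, wf W E d -> good zx f W E d /\ good zy g W E d.
Proof.
move=> fg clX clY W E d w.
suff: [/\ good zx f W E d, good_pure zx f W E d, good zy g W E d & good_pure zy g W E d].
  by case.
have [k] := ubnP (#|W| + #|E|); elim: k W E d w => // k IH W E d w sz.
have {}IH W' E' d' : wf W' E' d' -> #|W'| + #|E'| < #|W| + #|E| ->
    [/\ good zx f W' E' d', good_pure zx f W' E' d', good zy g W' E' d' & good_pure zy g W' E' d'].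
  by move=> w' s'; apply: IH => //; apply: leq_trans s' _.
have IH1 W' E' d' (w' : wf W' E' d') (s' : #|W'| + #|E'| < #|W| + #|E|) :
    [/\ good zx f W' E' d', good_pure zx f W' E' d' & good zy g W' E' d'].
  by case: (IH _ _ _ w' s').
have IH2 W' E' d' (w' : wf W' E' d') (s' : #|W'| + #|E'| < #|W| + #|E|) :
    [/\ good zy g W' E' d', good_pure zy g W' E' d' & good zx f W' E' d'].
  by case: (IH _ _ _ w' s').
have gf := joint_sym fg.
(* The pure statements rely on smaller forests only, so each is available to the opposite side for
   the same [W], [E] and [d]. *)
have p1 := good_pure_step fg clX clY w IH1.
have p2 := good_pure_step gf clY clX w IH2.
by split=> //; [exact: (good_step fg clX clY) | exact: (good_step gf clY clX)].
Qed.

End Generation.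

Section Effect.
Variables (S : finType) (ar : S -> nat) (L : finType).
Notation struct := (struct ar).
Notation rstruct := (rstruct ar).
Notation V A := 'I_(nv A).
Local Notation rel := Defs.rel.
Local Notation blk A := {s : S & (ar s).-tuple 'I_(nv A)}.
Notation target := (target ar L).

Variables (O : struct -> Prop) (m : nat) (P : 'I_m -> rstruct -> Prop).
Hypothesis O_forest : forall A, O A -> forest A.
Hypothesis P_cover : forall D, forest (tag D) -> exists c, cls O P D c.
Local Notation effect := (@effect _ _ L O m P).

Lemma dot_forest : forest (tag (dot ar)).
Proof.
split=> [s t|[k [xs [bs [k2 xi _ _]]]]]; first by rewrite inE.
have /xi/(congr1 val) : xs (Ordinal (ltnW k2)) = xs (Ordinal k2) by rewrite !ord1.
by [].
Qed.

Lemma residual_dot (C : struct) z : O C -> residual O (subr setT (blocks C) z) (dot ar).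
Proof.
move=> OC; exists C; split=> //; exists (@sub_val _ _ C setT (blocks C) z), (fun=> z).
split; first split.
- exact: sub_val_inj.
- by move=> x y _; rewrite !ord1.
- exact: sub_val_root.
- move=> x y e; rewrite ord1; split=> //.
  by apply: (@sub_val_inj _ _ C setT (blocks C) z); rewrite e sub_val_root.
split=> [x|s t].
  by left; have [|y] := @sub_val_surj _ _ C setT (blocks C) z x; [rewrite inE|exists y].
split=> [h|[[t' /sub_rel h ->]|[t']]]; last by rewrite inE.
  left; have [t' ht] : exists t' : (ar s).-tuple _, forall l, @sub_val _ _ C setT (blocks C) z (tnth t' l) = tnth t l.
    apply: (tuple_choice (P := fun l x => @sub_val _ _ C setT (blocks C) z x = tnth t l)) => l.
    by apply: sub_val_surj; rewrite inE.
  have e : t = map_tuple (@sub_val _ _ C setT (blocks C) z) t'.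
    by apply: eq_from_tnth => l; rewrite tnth_map.
  by exists t' => //; apply/sub_rel; rewrite -e inE.
by move: h; rewrite inE.
Qed.

Lemma real_sym X Y ox oy c : real O P (X := X) (Y := Y) ox oy c -> @real _ _ L O _ P Y X oy ox c.
Proof. by move=> [D hD [f [g [/joint_sym j e1 e2]]]]; exists D => //; exists g, f. Qed.

(** Gluing on a single point adds nothing, so the member of [O] given by the residual is a copy of
    the realizer. *)
Lemma real_accepts X Y ox oy c : real O P (X := X) (Y := Y) ox oy c ->
  P c (dot ar) -> @accepts _ _ L O X Y.
Proof.
move=> [D hD [f [g [[j1 j2] e1 e2]]]] /(hD _ dot_forest).
move=> [C [[fA [fB [[iA iB e0 ov] [cov R]]]] OC]].
have /choice[q hq] : forall z, exists x, z = fA x.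
  by move=> z; case: (cov z) => // -[y ->]; exists (tagged D); rewrite e0 [y]ord1.
exists C => //; exists (f \o q), (g \o q); split=> [x|s t]; first exact: j1.
have qK x : q (fA x) = x by apply: iA.
rewrite R => -[[t' /j2 h ->]|[t']]; last by rewrite inE.
by case: h => -[tx h1 h2]; [left|right]; exists tx => //; rewrite -h2 map_tuple_comp;
  apply: eq_map_tuple => l /=; rewrite qK.
Qed.

Definition offer (X Y : target) : param S L m :=
  (hangable O P X Y, floatable O P X Y, nullary Y).

Lemma offer_closed X Y : saturated O P X Y (offer X Y) (offer Y X).
Proof.
split=> //= [l c x lx|c x] /(gen_real O_forest).
  move=> h; rewrite inE; apply/asboolP; exists x => // y ly; apply: real_sym.
  by apply: h; rewrite /= lx ly.
by case=> oy _ r; rewrite inE; apply/asboolP; exists x, oy; apply: real_sym.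
Qed.

Lemma effect_gen X X' z : effect X = effect X' ->
  [/\ forall l c x, lab x = Some l -> @gen _ _ _ O _ P X z.1.1 z.1.2 z.2 true x c ->
        exists2 x', lab x' = Some l & @gen _ _ _ O _ P X' z.1.1 z.1.2 z.2 true x' c,
      forall c x, @gen _ _ _ O _ P X z.1.1 z.1.2 z.2 false x c ->
        exists x', @gen _ _ _ O _ P X' z.1.1 z.1.2 z.2 false x' c &
      nullary X = nullary X'].
Proof.
move=> /ffunP/(_ z); rewrite !ffunE => -[/setP e1 /setP e2 e3]; split=> //.
  move=> l c x lx gx; have := e1 (l, c); rewrite !inE /= => e.
  by apply/asboolP; rewrite -e; apply/asboolP; exists x.
move=> c x gx; have := e2 c; rewrite !inE /= => e.
by apply/asboolP; rewrite -e; apply/asboolP; exists x.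
Qed.

(* What X' and Y offer to each other is also closed for the pair X, Y because X
   and X' have the same effect; so whatever is generated in the amalgam of X and Y
   is realized in the amalgam of X' and Y. *)
Lemma accepts_effect X X' Y : effect X = effect X' ->
  @accepts _ _ L O X Y -> @accepts _ _ L O X' Y.
Proof.
move=> ef [C OC [f [g fg]]].
have [g1 g2 gn] := effect_gen (offer X' Y) ef.
have [c1 c2 c3 c4] := offer_closed X' Y.
have [d1 d2 d3 d4] := offer_closed Y X'.
have clX : saturated O P X Y (offer X' Y) (offer Y X').
  split=> //; last by rewrite gn.
    by move=> l c x lx /(g1 _ _ _ lx)[x' lx' /(c1 _ _ _ lx')].
  by move=> c x /g2[x' /c2].
have clY : saturated O P Y X (offer Y X') (offer X' Y) by split=> //; rewrite gn.
(* Without a vertex there is no root to generate from; all blocks of [C] then have arity 0, and the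
   nullary part of the effect transfers them. *)
case: (posnP (nv C)) => [C0|Cpos].
  have F (x : V C) : False by have := ltn_ord x; rewrite [X in _ < X]C0.
  exists C => //; exists (fun=> None), g; split=> [x|s t h]; first by case: (F x).
  case: (fg.2 _ _ h) => [[tx htx e]|]; [left|by right].
  have s0 : ar s = 0.
    case es : (ar s) => [//|k]; have l : 'I_(ar s) by rewrite es; apply: ord0.
    by case: (F (tnth t l)).
  have : s \in nullary X by rewrite inE; apply/asboolP; split=> //; exists tx.
  rewrite gn inE => /asboolP[_ [tx' h']]; exists tx' => //.
  by apply: eq_from_tnth => l; have := ltn_ord l; rewrite [X in _ < X]s0.
have z : V C := Ordinal Cpos.
have fC := O_forest OC.
have w : wf setT (blocks C) z by split=> // [|b x _ _]; rewrite inE.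
have [c hc] : exists c, cls O P (subr setT (blocks C) z) c.
  exact/P_cover/sub_forest.
have Pc : P c (dot ar) by apply/(hc _ dot_forest)/residual_dot.
have [gd1 gd2] := good_all P_cover fC fg clX clY w.
have := fg.1 z; case efz : (f z) => [x|]; last case egz : (g z) => [y|//] _.
  move=> _; have /g2[x' /(gen_real O_forest)[oy _ r]] := gd1 _ _ hc efz.
  exact: real_accepts r Pc.
have /(gen_real O_forest)[oy _ r] := gd2 _ _ hc egz.
exact/accepts_sym/(real_accepts r).
Qed.

End Effect.

(** * Cores and sections *)

Section Cores.
Variables (S : finType) (ar : S -> nat).
Notation struct := (struct ar).
Notation rstruct := (rstruct ar).
Notation V A := 'I_(nv A).
Local Notation rel := Defs.rel.

Lemma homf_comp (A B C : struct) (f : V A -> V B) (g : V B -> V C) :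
  homf f -> homf g -> homf (g \o f).
Proof. by move=> hf hg s t /hf/hg; rewrite map_tuple_comp. Qed.

Lemma hom_trans (A B C : struct) : hom A B -> hom B C -> hom A C.
Proof. by move=> [f hf] [g hg]; exists (g \o f); apply: homf_comp hf hg. Qed.

(** By finiteness an injective endomorphism permutes the tuples of each relation. *)
Lemma endo_inverse (T : struct) (e : V T -> V T) : homf e -> injective e ->
  exists2 e', homf e' & cancel e' e.
Proof.
move=> he ei; exists (invF ei); last exact: f_invF.
move=> s t ht.
have sub : [set map_tuple e u | u in rel T s] \subset rel T s.
  by apply/subsetP => _ /imsetP[u hu ->]; apply: he.
have : t \in [set map_tuple e u | u in rel T s].
  suff -> : [set map_tuple e u | u in rel T s] = rel T s by [].
  by apply/eqP; rewrite eqEcard sub card_imset ?leqnn // => u v /(map_tuple_inj ei).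
case/imsetP => u hu ->; rewrite map_tuple_comp map_tuple_id // => l.
exact: invF_f.
Qed.

(** The substructure on the image of [e] is again equivalent to [A], so it cannot have fewer
    vertices than [T]. *)
Lemma core_endo_inj (T A : struct) (e : V T -> V T) :
  is_core_of T A -> homf e -> injective e.
Proof.
move=> [hAT [hTA mn]] he.
pose D := mk (fun s (t : (ar s).-tuple {x | x \in codom e}) => map_tuple val t \in rel T s).
have TD : hom T D.
  exists (fun x => mk_in _ (exist _ (e x) (codom_f e x))) => s t ht.
  apply/mk_rel; rewrite !map_tuple_comp (_ : map_tuple _ t = map_tuple e t); first exact: he.
  by apply: eq_map_tuple => l; rewrite /= mk_inK.
have DT : hom D T.
  by exists (val \o @mk_out _ _ _ _) => s t /mk_rel; rewrite map_tuple_comp.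
have := mn D (hom_trans hAT TD) (hom_trans DT hTA).
rewrite /= card_sig => le; apply/injectiveP; apply/card_uniqP.
rewrite size_codom card_ord; apply/eqP; rewrite eqn_leq; apply/andP; split.
  by rewrite -[X in _ <= X]card_ord max_card.
exact: le.
Qed.

(* If T is the core of a minimal A, then for f : C -> T minimality gives some
   T -> A -> C; composed with f it is an automorphism of T. Conversely sections of
   all maps onto T force T to be a core: apply them to endomorphisms of T. *)
Lemma cores_of_minimalP (O : struct -> Prop) (T : struct) : cores_of_minimal O T <->
  (exists2 C, O C & hom C T) /\
  (forall C (f : V C -> V T), O C -> homf f -> exists2 g : V T -> V C, homf g & cancel g f).
Proof.
split=> [[A [[OA mA] coreT]]|[[A OA hAT] sec]].
  have [hAT [hTA mn]] := coreT; split; first by exists A.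
  move=> C f OC hf.
  have [k hk] : hom T C.
    by apply/(hom_trans hTA)/(mA _ OC)/hom_trans/hTA; exists f.
  have he := homf_comp hk hf.
  have [e' he' K] := endo_inverse he (core_endo_inj coreT he).
  by exists (k \o e'); [exact: homf_comp he' hk | move=> x; exact: K].
have [f hf] := hAT; have [g hg K] := sec _ _ OA hf.
exists A; split; first split=> // C OC [h hh].
  have [g' hg' _] := sec _ _ OC (homf_comp hh hf).
  by exists (g' \o f); apply: homf_comp hf hg'.
split=> //; split; first by exists g.
move=> D [p hp] [q hq].
have [g' hg' K'] := sec _ _ OA (homf_comp (homf_comp hp hq) hf).
have pi : injective (p \o g') by apply: (can_inj (g := f \o q)) => x; exact: K'.
by have := leq_card _ pi; rewrite !card_ord.
Qed.

Lemma glued_exists (A : struct) (a : V A) (B : struct) (b : V B) :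
  exists C, glued a b C.
Proof.
pose hB (y : V B) : V A + {y | y != b} :=
  if insub y is Some y' then inr y' else inl a.
have hBb : hB b = inl a by rewrite /hB insubF ?eqxx.
have hBn y : y != b -> exists y', hB y = inr y' /\ val y' = y.
  by move=> yb; rewrite /hB (insubT (fun y => y != b) yb); eexists.
have hBi : injective hB.
  move=> x y; have [->|/hBn[x' [-> <-]]] := eqVneq x b;
    have [->|/hBn[y' [-> <-]]] := eqVneq y b; rewrite ?hBb //.
  by case=> ->.
exists (mk (fun s (t : (ar s).-tuple (V A + {y | y != b})) =>
  (exists2 tA, tA \in rel A s & t = map_tuple inl tA) \/
  (exists2 tB, tB \in rel B s & t = map_tuple hB tB))).
exists (fun x => mk_in _ (inl x)), (fun y => mk_in _ (hB y)); split.
  split=> [x y /(can_inj (mk_inK _))[]//|x y /(can_inj (mk_inK _))/hBi//||x y].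
    by rewrite hBb.
  move=> /(can_inj (mk_inK _)); have [->|/hBn[y' [-> _]]//] := eqVneq y b.
  by rewrite hBb => -[->].
split=> [z|s t].
  rewrite -(mk_outK z); case: (mk_out z) => [x|y']; first by left; exists x.
  right; exists (val y'); have [y'' [-> /val_inj->]] := hBn _ (valP y'); by [].
rewrite mk_rel; split=> -[[tA hA e]|[tB hB' e]]; [left|right|left|right].
- exists tA => //; apply: eq_from_tnth => l; move/map_tuple_eqP: e => e.
  by rewrite tnth_map -(mk_outK (tnth t l)) e.
- exists tB => //; apply: eq_from_tnth => l; move/map_tuple_eqP: e => e.
  by rewrite tnth_map -(mk_outK (tnth t l)) e.
- exists tA => //; rewrite e map_tuple_comp; apply: eq_map_tuple => l /=; exact: mk_inK.
- exists tB => //; rewrite e map_tuple_comp; apply: eq_map_tuple => l /=; exact: mk_inK.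
Qed.

End Cores.

(** * Sections of partial maps to a forest *)

Section Sections.
Variables (S : finType) (ar : S -> nat).
Notation struct := (struct ar).
Notation V A := 'I_(nv A).
Local Notation rel := Defs.rel.
Local Notation blk A := {s : S & (ar s).-tuple 'I_(nv A)}.

Variable A : struct.
Hypothesis fA : forest A.
Implicit Types (v x y : V A) (b : blk A).

Local Notation linked := (connect (adj (blocks A))).

(* x is the vertex of b nearest to v *)
Definition parent v b x :=
  [/\ b \in blocks A, x \in tagged b & connect (adj (blocks A :\ b)) v x].

Lemma parent_uniq v b x y : parent v b x -> parent v b y -> x = y.
Proof.
move=> [bA xb cx] [_ yb cy]; apply: (forest_acyclic (E := blocks A :\ b) fA _ bA) => //.
- exact: subsetDl.
- by rewrite !inE eqxx.
- by apply: connect_trans cy; rewrite connect_adj_sym.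
Qed.

Lemma parent_exists v b y : b \in blocks A -> y \in tagged b -> linked v y ->
  exists x, parent v b x.
Proof. by move=> bA yb /(connect_avoid b)[c|[x xb c]]; [exists y|exists x]. Qed.

Lemma parent_linked v b x y : parent v b x -> y \in tagged b -> linked v y.
Proof.
move=> [bA xb c] yb; apply: connect_trans (connect_block bA xb yb).
exact: connect_adjS (subsetDl _ _) c.
Qed.

Lemma avoid_parent v b b' z : connect (adj (blocks A :\ b)) v z -> b' \in blocks A ->
  connect (adj (blocks A :\ b')) v z \/
  exists2 x, parent v b' x & connect (adj (blocks A :\ b)) v x.
Proof.
move=> /(connect_avoid b') h b'A.
have s1 : blocks A :\ b :\ b' \subset blocks A :\ b' by apply: setSD; apply: subsetDl.
have s2 : blocks A :\ b :\ b' \subset blocks A :\ b by apply: subsetDl.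
case: h => [c|[x xb c]]; first by left; apply: connect_adjS c.
by right; exists x; [split=> //; apply: connect_adjS c | apply: connect_adjS c].
Qed.

(** If the blocks differed, [y] could be reached through one of them without using the other, and
    would be the parent of that other block. *)
Lemma child_uniq v b b' x x' y : parent v b x -> parent v b' x' ->
  y \in tagged b -> y \in tagged b' -> y <> x -> y <> x' -> b = b'.
Proof.
move=> pb pb' yb yb' yx yx'; have [//|bb'] := eqVneq b b'.
have [bA xb cx] := pb; have [b'A xb' cx'] := pb'.
case: (avoid_parent cx b'A) => [c|[x2 px2 c]].
  case: yx'; apply: parent_uniq pb'; split=> //.
  by apply: connect_trans c (connect_block _ xb yb); rewrite in_setD1 bb'.
have e := parent_uniq px2 pb'; subst x2.
case: yx; apply: parent_uniq pb; split=> //.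
by apply: connect_trans c (connect_block _ xb' yb'); rewrite in_setD1 eq_sym bb'.
Qed.

(** Its size is the measure for descents away from [v]. *)
Definition below v b : {set V A} := [set z | ~~ connect (adj (blocks A :\ b)) v z].

Lemma below_lt v b x y b' : parent v b x -> y \in tagged b -> y <> x ->
  parent v b' y -> #|below v b'| < #|below v b|.
Proof.
move=> pb yb yx pb'; have [bA xb cx] := pb; have [b'A yb' cy'] := pb'.
have ncy : ~~ connect (adj (blocks A :\ b)) v y.
  by apply/negP => cy; apply: yx; apply: parent_uniq pb; split.
apply: proper_card; apply/properP; split; last first.
  by exists y; rewrite !inE // negbK.
apply/subsetP => z; rewrite !inE; apply: contraNN => cz.
case: (avoid_parent cz b'A) => [//|[x2 px2 c]].
by rewrite (parent_uniq px2 pb') (negPf ncy) in c.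
Qed.

Section Survive.
Variables (C : struct) (p : V C -> option (V A)).

Definition lies_over b (tc : (ar (tag b)).-tuple (V C)) :=
  tc \in rel C (tag b) /\ map_tuple p tc = map_tuple Some (tagged b).

(* d survives if the part of A lying behind p d, as seen from v, lifts to C
   through d. *)
Inductive survives v (d : V C) : Prop :=
  Survives of forall x b, p d = Some x -> parent v b x ->
    exists tc, [/\ lies_over (b := b) tc, d \in tc & forall e, e \in tc -> e != d -> survives v e].

Lemma not_survives v d x : p d = Some x -> ~ survives v d ->
  exists2 b, parent v b x & forall tc, lies_over (b := b) tc -> d \in tc ->
    exists e, [/\ e \in tc, e != d & ~ survives v e].
Proof.
move=> pd ns; apply: contrapT => no; apply: ns; constructor=> x' b.
rewrite pd => -[<-] pb; apply: contrapT => no2; apply: no; exists b => // tc ov dt.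
apply: contrapT => no3; apply: no2; exists tc; split=> // e et ed.
by apply: contrapT => ne; apply: no3; exists e.
Qed.

Definition good_lift v d b (tc : (ar (tag b)).-tuple (V C)) :=
  [/\ lies_over (b := b) tc, d \in tc & forall e, e \in tc -> e != d -> survives v e].

(** The lift is fixed by [v], [d] and [b] alone, so that all vertices of a block follow the same
    one. *)
Definition lift_of v d b : option ((ar (tag b)).-tuple (V C)) :=
  [pick tc | `[< good_lift v d tc >]].

Lemma lift_ofP v d b tc : lift_of v d b = Some tc -> good_lift v d tc.
Proof. by rewrite /lift_of; case: pickP => // tc' /asboolP h [<-]. Qed.

Lemma lift_of_exists v d b x : survives v d -> p d = Some x -> parent v b x ->
  exists tc, lift_of v d b = Some tc.
Proof.
move=> [h] pd pb; rewrite /lift_of; case: pickP => [tc _|no]; first by exists tc.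
by have [tc htc] := h _ _ pd pb; have /asboolPn := negbT (no tc).
Qed.

Lemma tnth_inj_block b : b \in blocks A -> injective (tnth (tagged b)).
Proof. by rewrite inE => /fA.1 /tuple_uniqP. Qed.

Lemma over_tnth b (tc : (ar (tag b)).-tuple (V C)) i :
  lies_over (b := b) tc -> p (tnth tc i) = Some (tnth (tagged b) i).
Proof. by move=> [_ /map_tuple_eqP]. Qed.

Section Trace.
Variables (v : V A) (d0 : V C).
Hypotheses (pd0 : p d0 = Some v) (sd0 : survives v d0).

(** The graph of the section: it starts at [d0] and crosses each block along its chosen lift. The
    condition on [k] leaves out the parent, whose image is already fixed. *)
Inductive trace : V A -> V C -> Prop :=
| trace0 : trace v d0
| traceS x d b tc k : trace x d -> parent v b x -> lift_of v d b = Some tc ->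
    tnth (tagged b) k <> x -> trace (tnth (tagged b) k) (tnth tc k).

Lemma traceP x d : trace x d -> p d = Some x /\ survives v d.
Proof.
elim=> {x d} [//|x d b tc k _ [pd sd] pb /lift_ofP[ov dt ch] ne].
have pe := over_tnth k ov; split=> //; apply: ch; first exact: mem_tnth.
by apply/eqP => e; move: pe; rewrite e pd => -[]; apply/nesym.
Qed.

Lemma trace_fun x d d' : trace x d -> trace x d' -> d = d'.
Proof.
move=> h; elim: h d' => {x d} [|x d b tc k hx IH pb lf ne] d' h'.
  move: {1 2}v h' (erefl v) => y h'; case: h' => // x d b tc k _ pb _ ne e.
  case: ne; have [bA _ _] := pb; apply: parent_uniq pb.
  by split=> //; [exact: mem_tnth | rewrite -e connect0].
move: {1 2}(tnth _ k) h' (erefl (tnth (tagged b) k)) => y h'.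
case: h' => [e|x' d1 b' tc' k' hx' pb' lf' ne' e].
  case: ne; have [bA _ _] := pb; apply: parent_uniq pb.
  by split=> //; [exact: mem_tnth | rewrite e connect0].
have yb' : tnth (tagged b) k \in tagged b' by rewrite -e mem_tnth.
have eb : b = b'.
  by apply: child_uniq pb pb' (mem_tnth _ _) yb' _ _ => //; rewrite -e.
subst b'; have ek : k = k'.
  by apply: (@tnth_inj_block b); [case: pb | rewrite -e].
subst k'; have ex := parent_uniq pb pb'; subst x'.
by move: lf'; rewrite -(IH _ hx') lf => -[->].
Qed.

Lemma trace_block x y z : trace x z -> adj (blocks A) x y -> exists d, trace y d.
Proof.
move=> hx /existsP[b /and3P[bA xb yb]].
have /tnthP[k ek] := yb.
have [u [d [hu pu]]] : exists u d, trace u d /\ parent v b u.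
  have [pbx|npbx] := pselect (parent v b x); first by exists x, z.
  have lx : linked v x.
    elim: hx {xb npbx} => {x z} [|x d b' tc k' _ _ pb' _ _]; first exact: connect0.
    exact: parent_linked pb' (mem_tnth _ _).
  have [u pu] := parent_exists bA xb lx.
  have ux : x <> u by move=> e; apply: npbx; rewrite e.
  case: hx xb npbx lx ux => {x z} [|x d b' tc k' hx pb' lf ne] xb npbx lx ux.
    by case: npbx; split=> //; apply: connect0.
  have e : b' = b by apply: child_uniq pb' pu (mem_tnth _ _) xb ne ux.
  by subst b'; exists x, d.
have [pd sd] := traceP hu; have [tc lf] := lift_of_exists sd pd pu.
have [yu|yu] := eqVneq y u; first by rewrite yu; exists d.
by exists (tnth tc k); rewrite ek; apply: traceS hu pu lf _; rewrite -ek; apply/eqP.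
Qed.

Lemma trace_total y : linked v y -> exists d, trace y d.
Proof.
move: y; apply: connect_ind => [|y z _ [d hd]]; first by exists d0; apply: trace0.
exact: trace_block hd.
Qed.

Lemma trace_section : exists g : V A -> V C, g v = d0 /\
  forall y, linked v y -> p (g y) = Some y /\
    forall b, b \in blocks A -> y \in tagged b -> map_tuple g (tagged b) \in rel C (tag b).
Proof.
have /choice[g hg] y : exists d, linked v y -> trace y d.
  have [l|nl] := boolP (linked v y); last by exists d0.
  by have [d] := trace_total l; exists d.
exists g; split; first exact: (trace_fun (hg _ (connect0 _ _)) trace0).
move=> y ly; have [pg _] := traceP (hg _ ly); split=> // b bA yb.
have [x px] := parent_exists bA yb ly.
have lb z : z \in tagged b -> linked v z by apply: parent_linked px.
have hx := hg x (lb x _); have [_ xb _] := px.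
have {}hx := hx xb; have [pd sd] := traceP hx.
have [tc lf] := lift_of_exists sd pd px; have [ov dt _] := lift_ofP lf.
rewrite (_ : map_tuple _ _ = tc); first by case: ov.
apply: eq_from_tnth => k; rewrite tnth_map.
have [e|ne] := eqVneq (tnth (tagged b) k) x.
  have /tnthP[k' ek'] := dt.
  have := over_tnth k' ov; rewrite -ek' pd => -[ex].
  have -> : k = k' by apply: (tnth_inj_block bA); rewrite -ex.
  by rewrite -ek' -ex.
apply: trace_fun (hg _ (lb _ (mem_tnth _ _))) (traceS hx px lf _).
exact/eqP.
Qed.

End Trace.

(** Components are lifted independently, that of [a] from [a] itself so as to hit [r]. Blocks of
    arity 0 belong to no component and are covered by the first hypothesis. *)
Lemma section_exists (a : V A) (r : V C) :
  (forall b, b \in blocks A -> ar (tag b) = 0 -> exists t, t \in rel C (tag b)) ->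
  p r = Some a -> survives a r ->
  (forall v, ~~ linked a v -> exists2 d, p d = Some v & survives v d) ->
  exists2 g : V A -> V C, homf g & (forall y, p (g y) = Some y) /\ g a = r.
Proof.
move=> nul pr sr others.
have sy := connect_adj_sym (blocks A).
pose rep y := if linked a y then a else root (adj (blocks A)) y.
have lrep y : linked (rep y) y.
  by rewrite /rep; case: ifP => // _; rewrite sy connect_root.
have rep_eq y z : linked y z -> rep y = rep z.
  move=> l; rewrite /rep (_ : linked a y = linked a z).
    by case: ifP => // _; apply/rootP.
  by rewrite ![linked a _]sy (same_connect sy l).
have rep_or y : rep y = a \/ ~~ linked a (rep y).
  rewrite /rep; case: ifPn => [|h]; [by left|right].
  by apply: contraNN h => l; apply: connect_trans l _; rewrite sy connect_root.
have /choice[G hG] v : exists g : V A -> V C, (v = a -> g a = r) /\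
   (v = a \/ ~~ linked a v -> forall y, linked v y -> p (g y) = Some y /\
    forall b, b \in blocks A -> y \in tagged b -> map_tuple g (tagged b) \in rel C (tag b)).
  have [->|va] := eqVneq v a.
    by have [g [ga hg]] := trace_section pr sr; exists g.
  have [lv|/others[d pd sd]] := boolP (linked a v).
    by exists (fun=> r); split=> [/eqP|[/eqP|//]]; rewrite (negPf va).
  have [g [ga hg]] := trace_section pd sd; exists g.
  by split=> // /eqP; rewrite (negPf va).
have GP y := (hG (rep y)).2 (rep_or y) y (lrep y).
exists (fun y => G (rep y) y).
  move=> s t ht; have bA : existT _ s t \in blocks A by rewrite inE.
  case: (posnP (ar s)) => es.
    have [t' ht'] := nul _ bA es; rewrite (_ : map_tuple _ _ = t') //.
    by apply: eq_from_tnth => l; have := ltn_ord l; rewrite [X in _ < X]es.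
  pose l0 : 'I_(ar s) := Ordinal es.
  have y0t : tnth t l0 \in t by apply: mem_tnth.
  have [_ /(_ _ bA y0t)] := GP (tnth t l0).
  rewrite (_ : map_tuple (G _) _ = map_tuple (fun y => G (rep y) y) t) //.
  apply: (@eq_from_tnth (ar s)) => l; rewrite !tnth_map /=; congr (G _ _); apply: rep_eq.
  exact: connect_block bA y0t (mem_tnth _ _).
have repa : rep a = a by rewrite /rep connect0.
split=> [y|]; first by have [] := GP y.
by rewrite repa; apply: (hG a).1.
Qed.

End Survive.
End Sections.

(** * Refuters of sections *)

Section Refuters.
Variables (S : finType) (ar : S -> nat).
Notation struct := (struct ar).
Notation rstruct := (rstruct ar).
Notation V A := 'I_(nv A).
Local Notation rel := Defs.rel.
Local Notation blk A := {s : S & (ar s).-tuple 'I_(nv A)}.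
Local Notation linked A := (connect (adj (blocks A))).

(* A label of the root tells which summand fails to lift; its second component is
   Some s if the failure is that the unary relation s is missing, a fact that both
   summands may have contributed. *)
Definition label := (bool * option S)%type.
Notation target := (target ar label).

Section Define.
Variables (A : struct) (a : V A).

(** With [o = Some s] the relation [s] is emptied, which serves to refute sections when [s] has
    arity 0. *)
Definition plain (o : option S) : target := @Target S ar label (V A)
  (fun s t => t \in rel A s /\ o <> Some s)
  (fun x => if x == a then Some (true, None) else None).

Section Refuter.
Variables (v : V A) (strict : bool) (root_ok : option (blk A) -> label -> Prop).

(* In a point (x, w, o) over x, w = Some b records that the part of A behind the
   block b, as seen from v, does not lift. *)
Definition refuter_ok (p : V A * option (blk A) * option label) :=
  [/\ forall b, p.1.2 = Some b -> parent v b p.1.1,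
      strict -> p.1.1 = v -> p.1.2 <> None &
      if p.1.1 == a then exists2 l, p.2 = Some l & root_ok p.1.2 l else p.2 = None].

Definition rpoint := {p | refuter_ok p}.
Definition vx (u : rpoint) := (sval u).1.1.
Definition vw (u : rpoint) := (sval u).1.2.
Definition vo (u : rpoint) := (sval u).2.

(** The second clause passes a failure on to a vertex behind the block. The third speaks of labels
    and so binds both sides: a unary block that the label declares missing cannot be supplied by the
    other summand. *)
Definition refuter : target := @Target S ar label rpoint
  (fun s t => [/\ map_tuple vx t \in rel A s,
     forall i, vw (tnth t i) = Some (existT _ s (map_tuple vx t)) ->
       exists j, vx (tnth t j) <> vx (tnth t i) /\ vw (tnth t j) <> None &
     forall i sd, ar s = 1 -> vo (tnth t i) <> Some (sd, Some s)]) vo.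

Lemma refuter_parent u b : vw u = Some b -> parent v b (vx u).
Proof. by have [h _ _] := svalP u; apply: h. Qed.

Lemma refuter_root u : vx u = a -> exists2 l, vo u = Some l & root_ok (vw u) l.
Proof.
by move=> e; have [_ _] := svalP u; rewrite -/(vx u) e eqxx.
Qed.

Lemma refuter_lab u : vo u <> None <-> vx u = a.
Proof.
by have [_ _] := svalP u; rewrite -/(vx u) -/(vo u); case: eqP => [e [l -> _]|ne ->]; split.
Qed.

Hypothesis fA : forest A.

Section Lift.
Variables (C : struct) (p : V C -> option (V A)).

(** A tuple over the block named by [w] contains a further failing point, as the second clause of
    the refuter demands. Over [v] itself a failure may go unrecorded, which leaves room for blaming
    the other summand. *)
Lemma refuter_lift (w : V C -> option (blk A)) (o : V C -> option label) :
  (forall d x b, p d = Some x -> w d = Some b -> parent v b x /\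
     forall tc, lies_over p (b := b) tc -> d \in tc ->
       exists e, [/\ e \in tc, e != d & ~ survives p v e]) ->
  (forall d x, p d = Some x -> x <> v -> ~ survives p v d -> w d <> None) ->
  (strict -> forall d, p d = Some v -> w d <> None) ->
  (forall d x, p d = Some x -> if x == a then exists2 l, o d = Some l & root_ok (w d) l
     else o d = None) ->
  (forall d sd s, p d = Some a -> o d = Some (sd, Some s) -> ar s = 1 ->
     forall t, t \in rel C s -> d \notin t) ->
  exists q : V C -> option (tv refuter), [/\ forall d, p d = None -> q d = None,
    forall d x, p d = Some x -> exists u : rpoint, [/\ q d = Some u, vx u = x & vo u = o d] &
    forall s (t : (ar s).-tuple _), t \in rel C s -> typed (X := plain None) p t -> typed q t].
Proof.
move=> h1 h2 h3 h4 h5.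
have /choice[q hq] d : exists ou : option rpoint, if p d is Some x then
    exists u : rpoint, [/\ ou = Some u, vx u = x, vw u = w d & vo u = o d] else ou = None.
  case pd : (p d) => [x|]; last by exists None.
  have ok : refuter_ok (x, w d, o d).
    split=> /= [b wd|st xv|]; first by case: (h1 _ _ _ pd wd).
      by apply: h3 => //; rewrite -xv.
    exact: h4.
  by exists (Some (exist _ _ ok)); eexists.
exists q; split=> [d pd|d x pd|s t ht [tx /= [htx _] /map_tuple_eqP e]].
- by have := hq d; rewrite pd.
- by have := hq d; rewrite pd => -[u [? ? _ ?]]; exists u.
have [tu htu] : exists tu : (ar s).-tuple rpoint, forall i,
   [/\ q (tnth t i) = Some (tnth tu i), vx (tnth tu i) = tnth tx i,
     vw (tnth tu i) = w (tnth t i) & vo (tnth tu i) = o (tnth t i)].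
  apply: (tuple_choice (P := fun i u => [/\ q (tnth t i) = Some u, vx u = tnth tx i,
     vw u = w (tnth t i) & vo u = o (tnth t i)])) => i.
  by have := hq (tnth t i); rewrite e.
have ex : map_tuple vx tu = tx.
  by apply: eq_from_tnth => i; rewrite tnth_map; have [] := htu i.
exists tu; last by apply/map_tuple_eqP => i; have [] := htu i.
split; rewrite ?ex // => i.
  have [_ ei wi _] := htu i; rewrite wi => wb.
  have [pb bad] := h1 _ _ _ (e i) wb.
  have ov : lies_over p (b := existT _ s tx) t by split=> //; apply/map_tuple_eqP.
  have [_ [/tnthP[j ->] ji nsj]] := bad t ov (mem_tnth _ _).
  have [_ ej wj _] := htu j; exists j; rewrite ej ei.
  have [bA _ _] := pb.
  have nij : tnth tx j <> tnth tx i.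
    move=> eji; have := @tnth_inj_block _ _ _ fA (existT _ s tx) bA j i eji => eij.
    by rewrite eij eqxx in ji.
  (* If the other failing point lay over [v], then [v] would be the parent of the block, that is,
     [tnth tx i]. *)
  split=> //; rewrite wj; apply: h2 (e j) _ nsj => jv; apply: nij.
  rewrite jv; apply: (parent_uniq fA (v := v) (b := existT _ s tx)) pb.
  by split=> //=; rewrite -?jv ?mem_tnth // jv connect0.
move=> sd s1; have [_ ei _ ->] := htu i => os.
have ia : tnth tx i = a.
  by apply: contraPP os => na; have := h4 _ _ (e i); case: eqP na => // _ _ ->.
have pia : p (tnth t i) = Some a by rewrite e ia.
by have /negP := h5 _ _ _ pia os s1 _ ht; apply; apply: mem_tnth.
Qed.

End Lift.

(** Along a section, a value [Some b] forces another such value at a vertex behind [b]; [below]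
    shrinks each time, so the descent is impossible. *)
Lemma refuter_sound C (q : V C -> option (tv refuter)) (g : V A -> V C) :
  (forall y, omap vx (q (g y)) = Some y) ->
  (forall b y u, parent v b y -> q (g y) = Some u -> vw u = Some b ->
     typed q (map_tuple g (tagged b))) ->
  forall y u, q (g y) = Some u -> vw u = None.
Proof.
move=> qg ty.
have vxg y u : q (g y) = Some u -> vx u = y by move=> e; move: (qg y); rewrite e => -[].
suff H k b y u : #|below v b| < k -> q (g y) = Some u -> vw u = Some b -> False.
  by move=> y u qu; case wu : (vw u) => [b|//]; case: (H _ b y u (leqnn _)).
elim: k b y u => // k IH b y u; rewrite ltnS => le qu wu.
have pb : parent v b y by rewrite -(vxg _ _ qu); apply: refuter_parent.
have [tu [tuA hc _] /map_tuple_eqP e] := ty _ _ _ pb qu wu.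
have {}e i : q (g (tnth (tagged b) i)) = Some (tnth tu i) by rewrite -e tnth_map.
have eb : map_tuple vx tu = tagged b.
  by apply: eq_from_tnth => i; rewrite tnth_map; apply: vxg.
have [_ yb _] := pb; have /tnthP[i ei] := yb.
have eu : tnth tu i = u by apply: Some_inj; rewrite -e -ei.
have [|j [nij wj]] := hc i; first by rewrite eu wu eb; case: (b).
case ewj : (vw (tnth tu j)) wj => [b'|//] _.
apply: (IH b' (tnth (tagged b) j) (tnth tu j)) => //.
apply: leq_trans le; apply: (below_lt fA pb (y := tnth (tagged b) j)).
- exact: mem_tnth.
- by rewrite -(vxg _ _ (e j)) -(vxg _ _ qu) -eu.
- by rewrite -(vxg _ _ (e j)); apply: refuter_parent.
Qed.

End Refuter.

Definition unary_of (w : option (blk A)) : option S :=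
  if w is Some b then if ar (tag b) == 1 then Some (tag b) else None else None.

(** When both summands agree on the label, exactly the side it names has [w <> None]. This replaces
    the removal of the point (root, [None]) and does not need [strict]. *)
Definition root_label (side : bool) (w : option (blk A)) (l : label) : Prop :=
  if l.1 == side then w <> None /\ l.2 = unary_of w else w = None.

Definition root_refuter (side : bool) := refuter a false (root_label side).
(** The constant label is that of [plain]: the other summand is attached whatever [w] is at the
    root. *)
Definition comp_refuter (v : V A) := refuter v true (fun _ l => l = (true, None)).

Record target_over (X : target) (pi : tv X -> V A) : Prop := TargetOver {
  over_rel : forall s t, @tr _ _ _ X s t -> map_tuple pi t \in rel A s;
  over_lab : forall u, lab u <> None <-> pi u = a }.

Lemma plain_over o : target_over (X := plain o) id.
Proof.
split=> [s t [ht _]|u /=]; first by rewrite map_tuple_id.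
by case: eqP => //; split.
Qed.

Lemma refuter_over v st ok : target_over (X := refuter v st ok) (@vx v st ok).
Proof. by split=> [s t []//|u]; apply: refuter_lab. Qed.

End Define.

Section TwoSides.
Variables (A : struct) (a : V A) (B : struct) (b : V B).
Hypotheses (fA : forest A) (fB : forest B).

Lemma joint_over X Y (pi : tv X -> V A) (rho : tv Y -> V B) C
    (f : V C -> option (tv X)) (g : V C -> option (tv Y)) :
  target_over a pi -> target_over b rho -> joint f g ->
  joint (X := plain a None) (Y := plain b None) (omap pi \o f) (omap rho \o g).
Proof.
move=> [Xr Xl] [Yr Yl] [h1 h2]; split=> [d|s t /h2].
  have := h1 d; rewrite /=; case: (f d) (g d) => [u|] [u'|] //=.
  - by move=> [e n]; rewrite (Xl u).1 // (Yl u').1 -?e // !eqxx.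
  - by move=> e; case: eqP => // /Xl.
  - by move=> e; case: eqP => // /Yl.
case=> -[tx htx /map_tuple_eqP e]; [left; exists (map_tuple pi tx)|right; exists (map_tuple rho tx)];
  try (by split=> //; auto); rewrite map_tuple_comp; apply/map_tuple_eqP => i /=; by rewrite e.
Qed.

Definition splits C (p : V C -> option (V A)) (q : V C -> option (V B)) :=
  exists gA gB, [/\ homf gA, homf gB, forall x, p (gA x) = Some x,
    forall y, q (gB y) = Some y & gA a = gB b].

Definition plain_joint C (p : V C -> option (V A)) (q : V C -> option (V B)) :=
  joint (X := plain a None) (Y := plain b None) p q.

Definition failing C := exists p q, @plain_joint C p q /\ ~ splits p q.

Definition jointly (X Y : target) C := exists f g, @joint _ _ _ X Y C f g.

Lemma nullary_fails s C : ar s = 0 ->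
  s \in nullary (plain a None) :|: nullary (plain b None) ->
  jointly (plain a (Some s)) (plain b (Some s)) C -> failing C.
Proof.
move=> s0 hs [f [g fg]]; exists f, g; split.
  have := joint_over (plain_over a (Some s)) (plain_over b (Some s)) fg.
  by congr (joint _ _); apply: funext => x /=; [case: (f x)|case: (g x)].
move=> [gA [gB [hA hB _ _ _]]].
have [t ht] : exists t, t \in rel C s.
  by move: hs; rewrite !inE => /orP[] /asboolP[_ [t [ht _]]]; eexists; [apply: hA ht|apply: hB ht].
by case: (fg.2 _ _ ht) => -[tx [_ h] _]; apply: h.
Qed.

End TwoSides.

(** Strictness records a failure over [v], against [refuter_sound]. A block lifting to the side of
    [B] has all its vertices over the root, so none in the component of [v] does. *)
Lemma comp_fails A (a : V A) B (b : V B) v C : forest A -> ~~ linked A a v ->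
  jointly (comp_refuter a v) (plain b None) C -> failing a b C.
Proof.
move=> fA nl [f [g fg]]; exists (omap (@vx _ _ _ _ _) \o f), g; split.
  have := joint_over (refuter_over a v true _) (plain_over b None) fg.
  by congr (joint _ _); apply: funext => x /=; case: (g x).
move=> [gA [gB [hA _ pA _ _]]].
have pA' y : omap (@vx _ _ _ _ _) (f (gA y)) = Some y by apply: pA.
have : omap (@vx _ _ _ _ _) (f (gA v)) = Some v by [].
case efv : (f (gA v)) => [u|//] /= -[xu].
have : vw u <> None by have [_ h _] := svalP u; apply: h.
apply; apply: (refuter_sound fA pA' _ efv) => b' y u' pb' fy wy.
have [bA yb' _] := pb'; have bC : map_tuple gA (tagged b') \in rel C (tag b').
  by apply: hA; rewrite inE in bA.
case: (fg.2 _ _ bC) => // -[ty _ /map_tuple_eqP e].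
case/negP: nl; have /tnthP[i ei] := yb'.
have := fg.1 (gA y); rewrite fy; have := e i; rewrite tnth_map -ei => -> /= [_ /(refuter_lab u')].
have -> : vx u' = y by have := pA' y; rewrite fy => -[].
move=> ya; rewrite -ya connect_adj_sym; exact: parent_linked pb' _.
Qed.

(** A block of [A] lifting only to the other side has all its vertices over the root, hence has
    arity 1. If it is the block recorded by [w], the label names its relation and the third clause
    of the other refuter excludes it. *)
Lemma root_typed A (a : V A) B (b : V B) side C
    (f : V C -> option (tv (root_refuter a side)))
    (g : V C -> option (tv (root_refuter b (~~ side)))) (gA : V A -> V C) :
  forest A -> joint f g -> homf gA -> (forall y, omap (@vx _ _ _ _ _) (f (gA y)) = Some y) ->
  forall y u, f (gA y) = Some u -> vw u = None.
Proof.
move=> fA fg hA pA.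
apply: (refuter_sound fA pA) => b' y u pb' fy wy.
have [bA yb' _] := pb'; have bC : map_tuple gA (tagged b') \in rel C (tag b').
  by apply: hA; rewrite inE in bA.
case: (fg.2 _ _ bC) => // -[ty [_ _ hty] /map_tuple_eqP e].
have alla z : z \in tagged b' -> z = a.
  case/tnthP => i ->; have := fg.1 (gA (tnth (tagged b') i)).
  have := e i; rewrite tnth_map => ->; have := pA (tnth (tagged b') i).
  by case: (f _) => [u'|] //= -[<-] [_ /refuter_lab].
have /tnthP[i ei] := yb'.
have s1 : ar (tag b') = 1.
  apply/eqP; rewrite eqn_leq (leq_ltn_trans _ (ltn_ord i)) // andbT leqNgt.
  apply/negP => lt; have := @tnth_inj_block _ _ _ fA b' bA (Ordinal (ltnW lt)) (Ordinal lt).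
  by rewrite (alla _ (mem_tnth _ _)) (alla _ (mem_tnth _ _)) => /(_ erefl).
have ya := alla _ yb'.
have xu : vx u = a by have := pA y; rewrite fy => -[->].
have [[sd so] ou] := refuter_root xu.
rewrite /root_label /= wy; case: eqP => // _ [_]; rewrite /unary_of (introT eqP s1) => eso.
have := fg.1 (gA y); rewrite fy; have := e i; rewrite tnth_map -ei => -> /= [].
by rewrite ou eso => /esym eo; case: (hty i sd s1).
Qed.

Lemma root_fails A (a : V A) B (b : V B) C : forest A -> forest B ->
  jointly (root_refuter a true) (root_refuter b false) C -> failing a b C.
Proof.
move=> fA fB [f [g fg]]; exists (omap (@vx _ _ _ _ _) \o f), (omap (@vx _ _ _ _ _) \o g).
split; first exact: joint_over (refuter_over a _ _ _) (refuter_over b _ _ _) fg.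
move=> [gA [gB [hA hB pA pB e]]].
have sA := root_typed (b := b) (side := true) fA fg hA pA.
have sB := root_typed (b := a) (side := false) fB (joint_sym fg) hB pB.
have := fg.1 (gA a); have := pA a; have := pB b; rewrite /= -e.
case ef : (f (gA a)) => [u|//]; case eg : (g (gA a)) => [u'|//] /= [xu'] [xu] [el _].
have [[sd so] ou okA] := refuter_root xu; have [l' ou' okB] := refuter_root xu'.
move: okA okB; rewrite (sA _ _ ef) (sB b u') -?e //.
have -> : l' = (sd, so) by apply: Some_inj; rewrite -ou' -el ou.
by rewrite /root_label /=; case: (sd) => /= [[h _] _|_ [h _]]; apply: h.
Qed.

End Refuters.

(** * Completeness: a missing section yields a map to an amalgam with a refuter *)

Section Completeness.
Variables (S : finType) (ar : S -> nat).
Notation struct := (struct ar).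
Notation rstruct := (rstruct ar).
Notation V A := 'I_(nv A).
Local Notation rel := Defs.rel.
Local Notation blk A := {s : S & (ar s).-tuple 'I_(nv A)}.
Local Notation linked A := (connect (adj (blocks A))).

Lemma survive_choice A (C : struct) (p : V C -> option (V A)) v :
  exists w : V C -> option (blk A), forall d x, p d = Some x ->
    (survives p v d -> w d = None) /\
    (~ survives p v d -> exists b, [/\ w d = Some b, parent v b x &
      forall tc, lies_over p (b := b) tc -> d \in tc ->
        exists e, [/\ e \in tc, e != d & ~ survives p v e]]).
Proof.
suff /choice[w hw] d : exists w : option (blk A), forall x, p d = Some x ->
    (survives p v d -> w = None) /\
    (~ survives p v d -> exists b, [/\ w = Some b, parent v b x &
      forall tc, lies_over p (b := b) tc -> d \in tc ->
        exists e, [/\ e \in tc, e != d & ~ survives p v e]]) by exists w.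
have [sd|nsd] := pselect (survives p v d); first by exists None.
case pd : (p d) => [x|]; last by exists None.
have [b pb hb] := not_survives pd nsd.
by exists (Some b) => _ [<-]; split=> // _; exists b.
Qed.

Lemma plain_jointC (A : struct) (a : V A) (B : struct) (b : V B) (C : struct) (p : V C -> option (V A)) q :
  plain_joint a b p q -> plain_joint b a q p.
Proof. exact: joint_sym. Qed.

Lemma plain_joint_root (A : struct) (a : V A) (B : struct) (b : V B) (C : struct) (p : V C -> option (V A)) q d :
  plain_joint a b p q -> p d = Some a -> q d = Some b.
Proof.
move=> [h _] pd; have := h d; rewrite pd; case: (q d) => [y|] /=; rewrite eqxx //.
by case: eqP => [->|_ [/esym]].
Qed.

Lemma comp_complete (A : struct) (a : V A) (B : struct) (b : V B) v (C : struct) (p : V C -> option (V A)) q :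
  forest A -> plain_joint a b p q -> v <> a ->
  (forall d, p d = Some v -> ~ survives p v d) ->
  jointly (comp_refuter a v) (plain b None) C.
Proof.
move=> fA hj va nsv; have [w hw] := survive_choice p v.
pose o d : option (label S) := if p d == Some a then Some (true, None) else None.
have [|d x pd _ nsd|_ d pd|d x pd|d sd s pd|f [f0 f1 f2]] :=
    @refuter_lift _ _ A a v true (fun _ l => l = (true, None)) fA C p w o.
- move=> d x b' pd wd; have [h1 h2] := hw _ _ pd.
  have [sd|/h2[b2 []]] := pselect (survives p v d); first by rewrite h1 in wd.
  by rewrite wd => -[<-].
- by have [_ /(_ nsd)[b' [->]]] := hw _ _ pd.
- by have [_ /(_ (nsv _ pd))[b' [->]]] := hw _ _ pd.
- rewrite /o pd; case: eqP => [->|xa]; first by rewrite eqxx; eexists.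
  by case: eqP => // -[].
- by rewrite /o pd eqxx.
exists f, q; split=> [d|s t ht]; last first.
  by case: (hj.2 _ _ ht) => h; [left; apply: f2|right].
have := hj.1 d; case pd : (p d) => [x|]; last by rewrite f0.
have [u [-> xu ou]] := f1 _ _ pd.
case: (q d) => [y|] /=; rewrite ou /o pd (inj_eq (@Some_inj _)); by case: eqP.
Qed.

(** A unary block on [d] would be a lift with no further point left to fail. *)
Lemma root_missing (A : struct) (a : V A) (C : struct) (p : V C -> option (V A)) b d s :
  p d = Some a -> parent a b a ->
  (forall tc, lies_over p (b := b) tc -> d \in tc ->
        exists e, [/\ e \in tc, e != d & ~ survives p a e]) ->
  unary_of (Some b) = Some s -> forall t, t \in rel C s -> d \notin t.
Proof.
move=> pd [_ ab _] bad; rewrite /unary_of; case: eqP => // s1 [<-] t ht.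
apply/negP => dt.
have one : forall i j : 'I_(ar (tag b)), i = j.
  by move=> i j; apply: val_inj; case: i j => [i hi] [j hj] /=; move: hi hj; rewrite s1; case: i j => [|i] [].
have /tnthP[i0 ei0] := dt; have /tnthP[j0 ej0] := ab.
have [|e [/tnthP[i ->] /eqP ne _]] := bad t _ dt.
  split=> //; apply/map_tuple_eqP => i; by rewrite (one i i0) -ei0 pd ej0 (one j0 i0).
by apply: ne; rewrite ei0 (one i i0).
Qed.

Lemma root_complete (A : struct) (a : V A) (B : struct) (b : V B) (C : struct) (p : V C -> option (V A)) q :
  forest A -> forest B -> plain_joint a b p q ->
  (forall d, p d = Some a -> survives p a d -> ~ survives q b d) ->
  jointly (root_refuter a true) (root_refuter b false) C.
Proof.
move=> fA fB hj ns.
have pq d := plain_joint_root (d := d) hj.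
have qp d := plain_joint_root (d := d) (plain_jointC hj).
have [wA hA] := survive_choice p a; have [wB hB] := survive_choice q b.
pose failA d := (p d == Some a) && ~~ `[< survives p a d >].
(* Where both sides fail, the failure of [B] is suppressed, because the label blames one side
   only. *)
pose wB' d := if failA d then None else wB d.
pose o d : option (label S) := if p d == Some a then
  (if failA d then Some (true, unary_of (wA d)) else Some (false, unary_of (wB d))) else None.
have h5 d sd s : p d = Some a -> o d = Some (sd, Some s) -> ar s = 1 ->
    forall t : (ar s).-tuple _, t \in rel C s -> d \notin t.
  move=> pd; rewrite /o /failA pd eqxx /=; case: asboolP => sv /= [_ e] _.
    have [_ /(_ (ns _ pd sv))[b' [eb pb bad]]] := hB _ _ (pq _ pd).
    by apply: root_missing (pq _ pd) pb bad _; rewrite -eb.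
  have [_ /(_ sv)[b' [eb pb bad]]] := hA _ _ pd.
  by apply: root_missing pd pb bad _; rewrite -eb.
have [|d x pd _ nsd|//|d x pd|//|f [f0 f1 f2]] :=
    @refuter_lift _ _ A a a false (root_label true) fA C p wA o.
- move=> d x b' pd wd; have [h1 h2] := hA _ _ pd.
  have [sd|/h2[b2 []]] := pselect (survives p a d); first by rewrite h1 in wd.
  by rewrite wd => -[<-].
- by have [_ /(_ nsd)[b' [->]]] := hA _ _ pd.
- rewrite /o /failA pd (inj_eq (@Some_inj _)); case: eqP => [xa|//].
  have [h1 h2] := hA _ _ pd; case: asboolP => sv /=; eexists; try by [].
    by rewrite /root_label /= h1.
  by rewrite /root_label /=; have [b' [-> _ _]] := h2 sv.
have [|d x pd xb nsd|//|d x pd|d sd s pd|g [g0 g1 g2]] :=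
    @refuter_lift _ _ B b b false (root_label false) fB C q wB' o.
- move=> d x b' pd; rewrite /wB'; case: (failA d) => // wd; have [h1 h2] := hB _ _ pd.
  have [sd|/h2[b2 []]] := pselect (survives q b d); first by rewrite h1 in wd.
  by rewrite wd => -[<-].
- rewrite /wB' /failA; case: eqP => [/pq|_ /=]; first by rewrite pd => -[].
  by have [_ /(_ nsd)[b' [->]]] := hB _ _ pd.
- case: eqP => [xb|xb].
    have pa : p d = Some a by apply: qp; rewrite pd xb.
    rewrite /o /wB' /failA pa eqxx /=; case: asboolP => sv /=; eexists; try by [].
    have [_ /(_ (ns _ pa sv))[b' [eb _ _]]] := hB _ _ pd.
    by rewrite /root_label /= eb.
  by rewrite /o; case: eqP => // /pq; rewrite pd => -[].
- exact: h5 (qp _ pd).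
exists f, g; split=> [d|s t ht]; last first.
  by case: (hj.2 _ _ ht) => h; [left; apply: f2|right; apply: g2].
have := hj.1 d; case pd : (p d) => [x|]; case qd : (q d) => [y|] //=.
- have [u [-> xu ou]] := f1 _ _ pd; have [u' [-> xu' ou']] := g1 _ _ qd.
  rewrite /= ou ou' => -[_]; case: eqP => // xa _; split=> //.
  by rewrite /o pd xa eqxx; case: ifP.
- have [u [-> xu ou]] := f1 _ _ pd; rewrite (g0 _ qd) /= ou /o pd (inj_eq (@Some_inj _)).
  by case: eqP.
- have [u [-> xu ou]] := g1 _ _ qd; rewrite (f0 _ pd) /= ou /o pd.
  by case: eqP.
Qed.

(** Outside the first three cases everything away from the root lifts. A root point surviving on
    both sides would then join two sections into one, so every root point fails on some side. *)
Lemma failing_complete (A : struct) (a : V A) (B : struct) (b : V B) (C : struct) : forest A -> forest B ->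
  failing a b C ->
  [\/ exists2 s, s \in nullary (plain a None) :|: nullary (plain b None) &
        jointly (plain a (Some s)) (plain b (Some s)) C,
      exists2 v, ~~ linked A a v & jointly (comp_refuter a v) (plain b None) C,
      exists2 v, ~~ linked B b v & jointly (plain a None) (comp_refuter b v) C |
      jointly (root_refuter a true) (root_refuter b false) C].
Proof.
move=> fA fB [p [q [hj ns]]].
have [nul|/existsNP[s /not_implyP[hs no]]] := pselect (forall s,
    s \in nullary (plain a None) :|: nullary (plain b None) -> exists t, t \in rel C s); last first.
  apply: Or41; exists s => //; exists p, q; split=> [d|s' t ht]; first exact: hj.1.
  have ss : Some s <> Some s' by move=> [e]; apply: no; rewrite e; exists t.
  by case: (hj.2 _ _ ht) => -[tx [h _] e]; [left|right]; exists tx.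
have [cA|/existsNP[v /not_implyP[nl no]]] := pselect (forall v, ~~ linked A a v ->
    exists2 d, p d = Some v & survives p v d); last first.
  apply: Or42; exists v => //; apply: comp_complete hj _ _ => //.
    by move=> e; rewrite e connect0 in nl.
  by move=> d pd sd; apply: no; exists d.
have [cB|/existsNP[v /not_implyP[nl no]]] := pselect (forall v, ~~ linked B b v ->
    exists2 d, q d = Some v & survives q v d); last first.
  apply: Or43; exists v => //.
  have [] := comp_complete fB (plain_jointC hj) (v := v).
  - by move=> e; rewrite e connect0 in nl.
  - by move=> d pd sd; apply: no; exists d.
  by move=> f [g /joint_sym]; exists g, f.
apply: Or44; apply: (root_complete fA fB hj) => r pr sA sB; apply: ns.
have nA b' : b' \in blocks A -> ar (tag b') = 0 -> exists t, t \in rel C (tag b').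
  move=> bA b0; apply: nul; rewrite !inE; apply/orP; left; apply/asboolP; split=> //.
  by exists (tagged b'); split=> //; rewrite inE in bA.
have nB b' : b' \in blocks B -> ar (tag b') = 0 -> exists t, t \in rel C (tag b').
  move=> bA b0; apply: nul; rewrite !inE; apply/orP; right; apply/asboolP; split=> //.
  by exists (tagged b'); split=> //; rewrite inE in bA.
have [gA hA [pA eA]] := section_exists fA nA pr sA cA.
have [gB hB [pB eB]] := section_exists fB nB (plain_joint_root hj pr) sB cB.
by exists gA, gB; split=> //; rewrite eA eB.
Qed.

End Completeness.

(** * Gluing *)

Section Gluing.
Variables (S : finType) (ar : S -> nat).
Notation struct := (struct ar).
Notation rstruct := (rstruct ar).
Notation V A := 'I_(nv A).
Local Notation rel := Defs.rel.
Local Notation blk A := {s : S & (ar s).-tuple 'I_(nv A)}.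
Local Notation linked A := (connect (adj (blocks A))).

Section Glued.
Variables (A : struct) (a : V A) (B : struct) (b : V B) (T : struct).
Variables (jA : V A -> V T) (jB : V B -> V T).
Hypotheses (iA : injective jA) (iB : injective jB) (jab : jA a = jB b).
Hypothesis ov : forall x y, jA x = jB y -> x = a /\ y = b.
Hypothesis cov : forall z, (exists x, z = jA x) \/ (exists y, z = jB y).
Hypothesis T_rel : forall s (t : (ar s).-tuple (V T)), t \in rel T s <->
  (exists2 tA, tA \in rel A s & t = map_tuple jA tA) \/
  (exists2 tB, tB \in rel B s & t = map_tuple jB tB).
Variable C : struct.

Definition coords (f : V C -> V T) (p : V C -> option (V A)) (q : V C -> option (V B)) :=
  (forall d x, p d = Some x <-> f d = jA x) /\ (forall d y, q d = Some y <-> f d = jB y).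

Lemma coords_exist f : homf f -> exists p q, coords f p q /\ plain_joint a b p q.
Proof.
move=> hf.
have /choice[p hp] d : exists o, forall x, o = Some x <-> f d = jA x.
  have [[x ex]|no] := pselect (exists x, f d = jA x); last first.
    by exists None => x; split=> // e; case: no; exists x.
  by exists (Some x) => x'; rewrite ex; split=> [[->]|/iA->].
have /choice[q hq] d : exists o, forall x, o = Some x <-> f d = jB x.
  have [[x ex]|no] := pselect (exists x, f d = jB x); last first.
    by exists None => x; split=> // e; case: no; exists x.
  by exists (Some x) => x'; rewrite ex; split=> [[->]|/iB->].
exists p, q; split; first by split.
split=> [d|s t /hf/T_rel[[tA hA /map_tuple_eqP e]|[tB hB /map_tuple_eqP e]]].
- case pd: (p d) => [x|]; case qd: (q d) => [y|] /=.
  + have [-> ->] : x = a /\ y = b by apply: ov; rewrite -(hp d x).1 // (hq d y).1.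
    by rewrite !eqxx.
  + case: eqP => // xa; move/hp: pd; rewrite xa jab => /hq; by rewrite qd.
  + case: eqP => // xa; move/hq: qd; rewrite xa -jab => /hp; by rewrite pd.
  + by case: (cov (f d)) => [[x /hp]|[y /hq]]; rewrite ?pd ?qd.
- by left; exists tA => //; apply/map_tuple_eqP => i; apply/hp.
- by right; exists tB => //; apply/map_tuple_eqP => i; apply/hq.
Qed.

Lemma coords_hom p q : plain_joint a b p q -> exists2 f, homf f & coords f p q.
Proof.
move=> hj.
have /choice[f hf] d : exists z, (forall x, p d = Some x <-> z = jA x) /\
    (forall y, q d = Some y <-> z = jB y).
  have := hj.1 d; case: (p d) => [x|]; case: (q d) => [y|] //=.
  - case: (eqVneq x a) => [->|_]; case: (eqVneq y b) => [->|_] [] // _ _.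
    exists (jA a); split=> z; first by split=> [[->]|/iA->].
    by rewrite jab; split=> [[->]|/iB->].
  - case: (eqVneq x a) => // xa _; exists (jA x); split=> z; first by split=> [[->]|/iA->].
    by split=> // /ov[e]; rewrite e eqxx in xa.
  - case: (eqVneq y b) => // yb _; exists (jB y); split=> z; last by split=> [[->]|/iB->].
    by split=> // /esym/ov[_ e]; rewrite e eqxx in yb.
exists f; last by split=> d; [apply: (hf d).1|apply: (hf d).2].
move=> s t /hj.2[] [tx [htx _] /map_tuple_eqP e]; apply/T_rel; [left|right]; exists tx => //;
  apply/map_tuple_eqP => i; [apply/((hf _).1)|apply/((hf _).2)]; exact: e.
Qed.

Lemma coords_section f p q : coords f p q ->
  (exists2 g, homf g & cancel g f) <-> splits a b p q.
Proof.
move=> [hp hq]; split=> [[g hg K]|[gA [gB [hA hB pA pB e]]]].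
  exists (g \o jA), (g \o jB); split.
  - move=> s t ht; rewrite -map_tuple_comp; apply: hg; apply/T_rel; by left; exists t.
  - move=> s t ht; rewrite -map_tuple_comp; apply: hg; apply/T_rel; by right; exists t.
  - by move=> x; apply/hp; rewrite /= K.
  - by move=> x; apply/hq; rewrite /= K.
  - by rewrite /= jab.
have /choice[g hg] z : exists c, (forall x, z = jA x -> c = gA x) /\
    (forall y, z = jB y -> c = gB y).
  case: (cov z) => [[x ->]|[y ->]].
    exists (gA x); split=> [x' /iA->//|y' /ov[-> ->]]; exact: e.
  exists (gB y); split=> [x' /esym/ov[-> ->]|y' /iB->//]; exact: esym.
have gjA x : g (jA x) = gA x by apply: (hg _).1.
have gjB x : g (jB x) = gB x by apply: (hg _).2.
exists g.
  move=> s t /T_rel[[tA hA' ->]|[tB hB' ->]]; rewrite map_tuple_comp.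
    by rewrite (_ : map_tuple _ _ = map_tuple gA tA); [apply: hA|apply: eq_map_tuple => l; apply: gjA].
  by rewrite (_ : map_tuple _ _ = map_tuple gB tB); [apply: hB|apply: eq_map_tuple => l; apply: gjB].
move=> z; case: (cov z) => [[x ->]|[y ->]]; first by rewrite gjA; apply/hp.
by rewrite gjB; apply/hq.
Qed.

End Glued.

Variable O : struct -> Prop.

Lemma cores_residual (Aa Bb : rstruct) : residual (cores_of_minimal O) Aa Bb <->
  accepts O (plain (tagged Aa) None) (plain (tagged Bb) None) /\
  ~ (exists2 C, O C & failing (tagged Aa) (tagged Bb) C).
Proof.
have key T : glued (tagged Aa) (tagged Bb) T -> cores_of_minimal O T <->
    accepts O (plain (tagged Aa) None) (plain (tagged Bb) None) /\
    ~ (exists2 C, O C & failing (tagged Aa) (tagged Bb) C).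
  move=> [jA [jB [[iA iB jab ov] [cov R]]]]; rewrite cores_of_minimalP.
  split=> -[[C OC h1] h2]; split.
  - have [f hf] := h1; have [p [q [_ hj]]] := coords_exist iA iB jab ov cov R hf.
    by exists C => //; exists p, q.
  - move=> [D OD [p [q [hj ns]]]]; apply: ns.
    have [f hf hc] := coords_hom iA iB jab ov R hj.
    by apply/(coords_section iA iB jab ov cov R hc); apply: h2.
  - have [p [q hj]] := h1; have [f hf _] := coords_hom iA iB jab ov R hj.
    by exists C => //; exists f.
  - move=> D f OD hf; have [p [q [hc hj]]] := coords_exist iA iB jab ov cov R hf.
    apply/(coords_section iA iB jab ov cov R hc); apply: contrapT => ns.
    by apply: h2; exists D => //; exists p, q.
split=> [[T [g c]]|h]; first exact/(key T).
by have [T g] := glued_exists (tagged Aa) (tagged Bb); exists T; split=> //; apply/(key T).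
Qed.

Lemma failing_acceptsP A (a : V A) B (b : V B) : forest A -> forest B ->
  (exists2 C, O C & failing a b C) <->
  [\/ exists2 s, s \in nullary (plain a None) :|: nullary (plain b None) &
        accepts O (plain a (Some s)) (plain b (Some s)),
      exists2 v, ~~ linked A a v & accepts O (comp_refuter a v) (plain b None),
      exists2 v, ~~ linked B b v & accepts O (plain a None) (comp_refuter b v) |
      accepts O (root_refuter a true) (root_refuter b false)].
Proof.
move=> fA fB; split=> [[C OC /(failing_complete fA fB)[[s hs j]|[v nl j]|[v nl j]|j]]|].
- by apply: Or41; exists s => //; exists C.
- by apply: Or42; exists v => //; exists C.
- by apply: Or43; exists v => //; exists C.
- by apply: Or44; exists C.
case=> [[s hs [C OC j]]|[v nl [C OC j]]|[v nl [C OC [f [g j]]]]|[C OC j]]; exists C => //.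
- have s0 : ar s = 0 by move: hs; rewrite !inE => /orP[] /asboolP[].
  exact: nullary_fails s0 hs j.
- exact: comp_fails j.
- have [p [q [hj ns]]] : failing b a C.
    by apply: comp_fails fB nl _; exists g, f; apply: joint_sym.
  exists q, p; split; first exact: plain_jointC.
  by move=> [gA [gB [h1 h2 h3 h4 h5]]]; apply: ns; exists gB, gA.
- exact: root_fails j.
Qed.

End Gluing.

Theorem theorem5p4 (S : finType) (ar : S -> nat) (O : struct ar -> Prop) :
  (forall A, O A -> forest A) ->
  iso_invariant O ->
  regular O ->
  regular (cores_of_minimal O).
Proof.
move=> O_forest _ [m [P P_cover]].
pose eff := @effect S ar (bool * option S)%type O m P.
pose F := {ffun param S (bool * option S)%type m -> param S (bool * option S)%type m}.
have swap := accepts_effect O_forest P_cover.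
(* The vertices [v] are unbounded in number, but their effects form a subset of the finite type
   [F]. *)
pose comps (D : rstruct ar) : {set F} :=
  [set e | `[< exists2 v, ~~ connect (adj (blocks (tag D))) (tagged D) v &
                  eff (comp_refuter (tagged D) v) = e >]].
pose type (D : rstruct ar) := (eff (plain (tagged D) None),
  [ffun s => eff (plain (tagged D) (Some s))], eff (root_refuter (tagged D) true), comps D).
have typeP D D' B : type D = type D' -> forest (tag D) -> forest (tag D') -> forest (tag B) ->
    residual (cores_of_minimal O) D B -> residual (cores_of_minimal O) D' B.
  move=> [e1 /ffunP e2 e3 /setP e4] fD fD' fB /cores_residual[h1 h2]; apply/cores_residual.
  split; first exact: swap e1 h1.
  move=> h3; apply: h2; move: h3; rewrite !failing_acceptsP //.
  case=> [[s hs h]|[v nl h]|[v nl h]|h].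
  - apply: Or41; exists s; last by apply: swap h; have := e2 s; rewrite !ffunE.
    have [_ _ ->] := effect_gen (set0, set0, set0) e1; exact: hs.
  - have : eff (comp_refuter (tagged D') v) \in comps D'.
      by rewrite inE; apply/asboolP; exists v.
    rewrite -e4 inE => /asboolP[v' nl' e]; apply: Or42; exists v' => //.
    exact: swap (esym e) h.
  - by apply: Or43; exists v => //; apply: swap (esym e1) h.
  - by apply: Or44; apply: swap (esym e3) h.
exists #|{: F * {ffun S -> F} * F * {set F}}|.
(* By [typeP] all forests of one type have the same residual, so this union over a type is the
   residual of each of them. *)
exists (fun i B => exists D, [/\ forest (tag D), enum_rank (type D) = i &
  residual (cores_of_minimal O) D B]).
move=> A fA; exists (enum_rank (type A)) => B fB; split=> [[D [fD /enum_rank_inj e h]]|h].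
  exact: typeP e fD fA fB h.
by exists A.
Qed.
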